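(* Let $\mathbb F$ be a field of characteristic $0$. Let $\{\lambda^n\}_{n\ge0}$ be a graded partition sequence and for each $n\geq0$ put $u_n=Q_{\lambda^n}(x;t)$. Then the set $\{u_n(x;t)\}_{n\geq0}$ is a system of algebraically independent generators of $\Lambda_{\mathbb{F}(t)}$ as an $\mathbb F(t)$-algebra. Moreover, for $\xi\in \mathbb F$ with $\xi\neq 0$ and $\xi$ not a root of unity, the sequence $\{u_n(x;\xi)\}_{n\ge0}$ of specializations is a system of algebraically independent generators of $\Lambda_{\mathbb F}$.
   Context: $\Lambda_K$ is the ring of symmetric functions in infinitely many variables over $K$. $P_\lambda(x;t)$ is the Hall–Littlewood symmetric function (inverse limit of $P_\lambda(x_1,\dots,x_N;t)=\frac{1}{v_\lambda(t)}\sum_{w\in S_N} w\big(x^{\lambda}\prod_{i<j}\frac{x_i-tx_j}{x_i-x_j}\big)$, $v_\lambda(t)=\prod_{i\ge0}\prod_{j=1}^{m_i}\frac{1-t^j}{1-t}$). Define $\phi_r(t)=(1-t)(1-t^2)\cdots(1-t^r)$ and $Q_\lambda(x;t)=\big(\prod_{i\ge1}\phi_{m_i(\lambda)}(t)\big)P_\lambda(x;t)$, where $m_i(\lambda)$ is the number of parts of $\lambda$ equal to $i$. Coefficients lie in $\mathbb Z[t]$, so specialization at $t=\xi$ is defined. A graded partition sequence has $\lambda^n\vdash n$.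
   Formalization: Since u_0 = Q_∅ = 1, the family indexed by n ≥ 0 is never algebraically independent; what is proved is that u_0 = 1 and that the u_n with n ≥ 1 are algebraically independent generators, in both parts of the statement. *)

(* Defs.v *)
From HB Require Import structures.
From mathcomp Require Import all_boot all_order all_algebra all_fingroup.
From mathcomp Require Import boolp classical_sets.
From mathcomp Require Import mpoly.

Set Implicit Arguments.
Unset Strict Implicit.
Unset Printing Implicit Defensive.

Import GRing.Theory.

Local Open Scope ring_scope.

Definition mpolys (K : comNzRingType) := forall N, {mpoly K[N]}.

Identity Coercion fun_of_mpolys : mpolys >-> Funclass.

HB.instance Definition _ K := Choice.on (mpolys K).

Section MPolys.
Variable K : comNzRingType.
Implicit Types (f g h : mpolys K) (a b : K).

Let zero : mpolys K := fun=> 0.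
Let opp f : mpolys K := fun N => - f N.
Let add f g : mpolys K := fun N => f N + g N.
Let one : mpolys K := fun=> 1.
Let mul f g : mpolys K := fun N => f N * g N.
Let scale a f : mpolys K := fun N => a *: f N.

Let addA : associative add.
Proof. by move=> f g h; apply: functional_extensionality_dep => N; apply: addrA. Qed.
Let addC : commutative add.
Proof. by move=> f g; apply: functional_extensionality_dep => N; apply: addrC. Qed.
Let add0 : left_id zero add.
Proof. by move=> f; apply: functional_extensionality_dep => N; apply: add0r. Qed.
Let addN : left_inverse zero opp add.
Proof. by move=> f; apply: functional_extensionality_dep => N; apply: addNr. Qed.
HB.instance Definition _ := GRing.isZmodule.Build (mpolys K) addA addC add0 addN.

Let mulA : associative mul.
Proof. by move=> f g h; apply: functional_extensionality_dep => N; apply: mulrA. Qed.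
Let mulC : commutative mul.
Proof. by move=> f g; apply: functional_extensionality_dep => N; apply: mulrC. Qed.
Let mul1 : left_id one mul.
Proof. by move=> f; apply: functional_extensionality_dep => N; apply: mul1r. Qed.
Let mulD : left_distributive mul add.
Proof. by move=> f g h; apply: functional_extensionality_dep => N; apply: mulrDl. Qed.
Let one_neq0 : one != zero.
Proof. by apply/eqP => /(congr1 (fun f : mpolys K => f 0%N)) /eqP; rewrite oner_eq0. Qed.
HB.instance Definition _ :=
  GRing.Zmodule_isComNzRing.Build (mpolys K) mulA mulC mul1 mulD one_neq0.

Let scaleA a b f : scale a (scale b f) = scale (a * b) f.
Proof. by apply: functional_extensionality_dep => N; apply: scalerA. Qed.
Let scale1 : left_id 1 scale.
Proof. by move=> f; apply: functional_extensionality_dep => N; apply: scale1r. Qed.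
Let scaleDr : right_distributive scale +%R.
Proof. by move=> a f g; apply: functional_extensionality_dep => N; apply: scalerDr. Qed.
Let scaleDl f : {morph scale^~ f : a b / a + b}.
Proof. by move=> a b; apply: functional_extensionality_dep => N; apply: scalerDl. Qed.
HB.instance Definition _ :=
  GRing.Zmodule_isLmodule.Build K (mpolys K) scaleA scale1 scaleDr scaleDl.

Let scaleAl a f g : a *: (f * g) = a *: f * g.
Proof. by apply: functional_extensionality_dep => N; apply: scalerAl. Qed.
HB.instance Definition _ := GRing.Lmodule_isLalgebra.Build K (mpolys K) scaleAl.
HB.instance Definition _ := GRing.Lalgebra_isComAlgebra.Build K (mpolys K).

End MPolys.

Section SymFun.
Variable K : comNzRingType.

(* Substitution x_{N+1} := 0. *)
Definition drop_var N (p : {mpoly K[N.+1]}) : {mpoly K[N]} :=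
  p \mPo [tuple if unlift ord_max i is Some j then 'X_j else 0 | i < N.+1].

(* The inverse limit is taken in graded rings, whence the degree bound. *)
Definition is_symfun (f : mpolys K) : Prop :=
  [/\ forall N, f N \is symmetric,
      forall N, drop_var (f N.+1) = f N
    & exists d, forall N, (msize (f N) <= d)%N].

Definition symfun_pred : {pred mpolys K} := fun f => `[< is_symfun f >].

Lemma symfun_subalg_closed : GRing.subalg_closed symfun_pred.
Proof.
split.
- apply/asboolP; split=> [N|N|]; first exact: rpred1.
    exact: rmorph1.
  by exists 1%N => N; rewrite msize1.
- move=> a f g /asboolP[fS fD [d fd]] /asboolP[gS gD [e ge]].
  apply/asboolP; split=> [N|N|]; first exact: (rpredD (rpredZ a (fS N)) (gS N)).
    rewrite -[RHS]/(a *: f N + g N) -fD -gD; exact: linearP.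
  exists (maxn d e) => N; rewrite -[X in msize X]/(a *: f N + g N).
  apply: (leq_trans (mmeasureD_le _ (a *: f N) (g N))).
  by rewrite geq_max !leq_max (leq_trans (msizeZ_le _ _) (fd N)) ge orbT.
- move=> f g /asboolP[fS fD [d fd]] /asboolP[gS gD [e ge]].
  apply/asboolP; split=> [N|N|]; first exact: (rpredM (fS N) (gS N)).
    rewrite -[RHS]/(f N * g N) -fD -gD; exact: rmorphM.
  exists (d + e).+1 => N; rewrite -[X in msize X]/(f N * g N).
  apply: (leq_trans (msizeM_le (f N) (g N))).
  by rewrite ltnS leq_add.
Qed.

HB.instance Definition _ :=
  GRing.isSubalgClosed.Build K (mpolys K) symfun_pred symfun_subalg_closed.

Record symfun := SymFun {
  symfun_val :> mpolys K;
  symfunP : symfun_val \in symfun_pred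
}.

HB.instance Definition _ := [isSub for symfun_val].
HB.instance Definition _ := [Choice of symfun by <:].
HB.instance Definition _ := [SubChoice_isSubComNzRing of symfun by <:].
HB.instance Definition _ := [SubNmodule_isSubLSemiModule of symfun by <:].
HB.instance Definition _ := [SubNzRing_SubLmodule_isSubLalgebra of symfun by <:].
HB.instance Definition _ := GRing.Lalgebra_isComAlgebra.Build K symfun.

End SymFun.

Section BaseChange.
Variables (R S : comNzRingType) (phi : {rmorphism R -> S}).

Lemma map_symfun_subproof (f : symfun R) :
  (fun N => map_mpoly phi (f N)) \in @symfun_pred S.
Proof.
have /asboolP[fS fD [d fd]] := symfunP f.
apply/asboolP; split=> [N|N|].
- by apply/issymP=> s; apply/mpolyP=> m;
    rewrite mcoeff_sym !mcoeff_map_mpoly -mcoeff_sym (issymP _ (fS N)).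
- rewrite -(fD N); set p := f N.+1.
  suff: drop_var (map_mpoly phi p) = map_mpoly phi (drop_var p) by [].
  elim/mpolyind: p => [|c m p _ _ IHp]; first by rewrite /drop_var !raddf0.
  rewrite /drop_var in IHp *; rewrite comp_mpolyD !(raddfD (map_mpoly phi)).
  rewrite comp_mpolyD IHp; congr (_ + _).
  rewrite /= !map_mpolyZ map_mpolyX !comp_mpolyZ map_mpolyZ !comp_mpolyX rmorph_prod.
  congr (_ *: _); apply: eq_bigr => i _.
  rewrite rmorphXn /= !tnth_mktuple; congr (_ ^+ _).
  by case: unlift => [j|]; rewrite ?raddf0 // map_mpolyX.
- exists d => N; apply: leq_trans (fd N).
  rewrite msizeE; apply/bigmax_leqP_seq => m; rewrite mcoeff_msupp mcoeff_map_mpoly => nz _.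
  apply: msize_mdeg_lt; rewrite mcoeff_msupp; apply: contraNneq nz => ->.
  by rewrite raddf0.
Qed.

Definition map_symfun (f : symfun R) : symfun S := SymFun (map_symfun_subproof f).

End BaseChange.

Definition is_partition (n : nat) (la : seq nat) : bool :=
  [&& sorted geq la, 0%N \notin la & sumn la == n].

Section HallLittlewood.
Variable la : seq nat.

Section Finite.
Variable N : nat.

(* la_{i+1}, with la padded by zeros. *)
Definition HL_part (i : 'I_N) : nat := nth 0%N la i.

(* In particular m_0 = N - size la. *)
Definition HL_mult (i : nat) : nat := #|[pred k : 'I_N | HL_part k == i]|.

Local Notation RatFun := {fraction {mpoly {poly int}[N]}}.
Local Notation x i := (tofrac ('X_i : {mpoly {poly int}[N]})).
Local Notation t := (tofrac (('X : {poly int})%:MP : {mpoly {poly int}[N]})).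

Definition HL_norm : RatFun :=
  \prod_(0 <= i < (sumn la).+1) \prod_(1 <= j < (HL_mult i).+1)
    ((1 - t ^+ j) / (1 - t)).

Definition HL_ratfun : RatFun :=
  HL_norm^-1 *
  \sum_(w : 'S_N)
    ((\prod_(i < N) x (w i) ^+ HL_part i) *
     \prod_(i < N) \prod_(j < N | (i < j)%N)
       ((x (w i) - t * x (w j)) / (x (w i) - x (w j)))).

End Finite.

(* The element of Lambda over Z[t] whose image in N variables is given, for
   every N >= size la, by the rational function above.  It is unique since
   tofrac is injective and since the images in N >= size la variables
   determine the others; that it exists (integrality and stability) is not
   proved here, and 0 would be returned if it did not. *)
Definition HL_P : symfun {poly int} :=
  xget 0 [set f : symfun {poly int} |
           forall N, (size la <= N)%N -> tofrac (f N) = HL_ratfun N].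

Definition HL_phi (r : nat) : {poly int} := \prod_(1 <= j < r.+1) (1 - 'X^j).

(* Every part of la is at most sumn la. *)
Definition HL_Q : symfun {poly int} :=
  (\prod_(1 <= i < (sumn la).+1) HL_phi (count_mem i la)) *: HL_P.

(* Q_la(x; tau), the image of Q_la under the morphism Z[t] -> K, t |-> tau;
   Q_la over F(t) is the case where tau is the indeterminate of F(t). *)
Definition HL_Q_at (K : comNzRingType) (tau : K) : symfun K :=
  map_symfun (horner_eval tau \o map_poly intr) HL_Q.

End HallLittlewood.

(* In a graded sequence (u_n)_{n >= 0} the term u_0 is the unit of the algebra,
   so the algebraically independent generators are the u_n with n >= 1. *)
Definition alg_indep_generators (K : comNzRingType) (A : comAlgType K)
    (u : nat -> A) : Prop :=
  let ev n : {mpoly K[n]} -> A :=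
    mmap (GRing.in_alg A) (fun i : 'I_n => u i.+1) in
  [/\ u 0%N = 1,
      forall n (p : {mpoly K[n]}), ev n p = 0 -> p = 0
    & forall a : A, exists n (p : {mpoly K[n]}), ev n p = a].

(* Main.v *)
(* P_la is the quotient H_la / D of two polynomials, where
   D = prod_(i < j) (x_i - x_j) and H_la / D is the sum over the distinct
   rearrangements g of la of x^g prod_(g i > g j) (x_i - t x_j) / (x_i - x_j).
   H_la is alternating, hence divisible by D over Z[t]; setting the last
   variable to 0 gives stability. Comparison with the sum over S_N needs
   sum_w prod_(i < j) (x_(w i) - t x_(w j)) / (x_(w i) - x_(w j)) = [N]_t!
   and its version restricted to the stabilizer of la, both of which follow
   from Lagrange interpolation by removing the last element of the ordering.

   At x_i = tau^i (i < N) a single rearrangement survives in H_la, and Q_la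
   takes the value tau^(n(la)) prod_(i < l(la)) (1 - tau^(N - i)): a polynomial
   in u = tau^N with a simple root at u = 1 when tau <> 0 is not a root of
   unity. Each e_k with k > 0 is also a polynomial in u, vanishing at u = 1
   (the case N = 0), so a polynomial in e_1, ..., e_(n-1) that is homogeneous
   of degree n has a double root there. Hence e_n occurs in Q_(la^n) with a
   nonzero coefficient, and the change of generators from (e_n) to (Q_(la^n))
   is triangular and invertible. *)
From mathcomp Require Import all_boot all_order all_algebra all_fingroup.
From mathcomp Require Import boolp.
From mathcomp Require classical_sets.
From mathcomp Require Import mpoly.
From mathcomp Require Import ring.
Require Import Defs.

Set Implicit Arguments.
Unset Strict Implicit.
Unset Printing Implicit Defensive.

Import GRing.Theory.

Local Open Scope ring_scope.

(** * Sums over orderings *)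

Section Lagrange.
Variables (L : fieldType) (I : finType) (C : {set I}) (x : I -> L).
Hypothesis x_inj : {in C &, injective x}.

(** [p] equals its Lagrange interpolant at the points [x a], in which each [N a] is monic of degree
    [#|C|.-1]. *)
Lemma coef_lagrange (p : {poly L}) : (size p <= #|C|)%N ->
  p`_(#|C|.-1) = \sum_(a in C) p.[x a] / \prod_(b in C | b != a) (x a - x b).
Proof.
move=> szp; pose N a := \prod_(b in C | b != a) ('X - (x b)%:P).
have NE a : N a = \prod_(b <- enum (C :\ a)) ('X - (x b)%:P).
  by rewrite big_enum /=; apply: eq_bigl => b; rewrite !inE andbC.
have szN a : a \in C -> size (N a) = #|C|.
  by move=> aC; rewrite NE size_prod_XsubC -cardE (cardsD1 a C) aC.
have hN a y : (N a).[y] = \prod_(b in C | b != a) (y - x b).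
  by rewrite horner_prod; apply: eq_bigr => b _; rewrite hornerXsubC.
pose q := \sum_(a in C) (p.[x a] / \prod_(b in C | b != a) (x a - x b)) *: N a.
have pq : p = q.
  apply/eqP; rewrite -subr_eq0; apply/eqP.
  apply: (@roots_geq_poly_eq0 _ _ [seq x a | a <- enum C]).
  - apply/allP => _ /mapP[a aC ->]; rewrite mem_enum in aC.
    rewrite rootE hornerD hornerN subr_eq0 /q [X in _ == X]horner_sum (bigD1 a) //=.
    rewrite [X in _ + X]big1 ?addr0 => [|b /andP[bC ba]].
      rewrite hornerZ hN divfK //; apply/prodf_neq0 => b /andP[bC ba].
      by rewrite subr_eq0; apply: contraNneq ba => /x_inj ->.
    by rewrite hornerZ hN [X in _ * X](bigD1 a) ?aC 1?eq_sym //= subrr mul0r mulr0.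
  - by rewrite map_inj_in_uniq ?enum_uniq // => a b; rewrite !mem_enum; apply: x_inj.
  rewrite size_map -cardE (leq_trans (size_polyD _ _)) // size_polyN geq_max szp /=.
  apply: (leq_trans (size_sum _ _ _)); apply/bigmax_leqP => a aC.
  by apply: leq_trans (size_scale_leq _ _) _; rewrite szN.
rewrite [in LHS]pq coef_sum; apply: eq_bigr => a aC; rewrite coefZ.
suff -> : (N a)`_#|C|.-1 = 1 by rewrite mulr1.
by rewrite -(szN a aC) -lead_coefE NE; apply/eqP/monic_prod_XsubC.
Qed.

End Lagrange.

Lemma size_coef_prod_linear (R : comNzRingType) (I : finType) (C : {set I}) (x : I -> R) (u : R) :
  let p := \prod_(b in C) (u *: 'X - (x b)%:P) in
  (size p <= #|C|.+1)%N /\ p`_#|C| = u ^+ #|C|.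
Proof.
rewrite -!big_enum cardE; elim: (enum C) => [|b s [IHs IHc]] /=.
  by rewrite !big_nil size_poly1 coef1.
rewrite big_cons; split.
  rewrite mulrBl mul_polyC -scalerAl mulrC (leq_trans (size_polyD _ _)) // geq_max size_polyN.
  apply/andP; split; apply: leq_trans (size_scale_leq _ _) _; last exact: leq_trans IHs _.
  by apply: leq_trans (size_polyMleq _ _) _; rewrite size_polyX addn2.
rewrite mulrBl coefB mul_polyC coefZ [X in _ - _ * X]nth_default // mulr0 subr0.
by rewrite -scalerAl coefZ coefXM /= IHc exprS.
Qed.

(** [F] vanishes at 0, so [F = G * 'X]. Then [coef_lagrange] applies to [G]: the second product of
    [F] vanishes at [x a], which makes [G.[x a]] equal to [t - 1] times a product over [b != a]. *)
Lemma sum_prod_HL (L : fieldType) (I : finType) (C : {set I}) (x : I -> L) (t : L) :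
    {in C &, injective x} -> (forall a, x a != 0) ->
  (1 - t) * \sum_(a in C) \prod_(b in C | b != a) ((x b - t * x a) / (x b - x a))
    = 1 - t ^+ #|C|.
Proof.
move=> x_inj x0.
pose F := \prod_(b in C) (t *: 'X - (x b)%:P) - \prod_(b in C) (1 *: 'X - (x b)%:P).
have linE u y b : (u *: 'X - (x b)%:P).[y] = u * y - x b.
  by rewrite hornerD hornerN hornerC hornerZ hornerX.
have F0 : root F 0.
  have E u : (\prod_(b in C) (u *: 'X - (x b)%:P)).[0] = \prod_(b in C) - x b.
    by rewrite horner_prod; apply: eq_bigr => b _; rewrite linE mulr0 add0r.
  by rewrite rootE hornerD hornerN !E subrr.
have [G FG] := factor_theorem _ _ F0; rewrite subr0 in FG.
have [->|/set0Pn[a0 a0C]] := eqVneq C set0.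
  by rewrite big_set0 mulr0 cards0 subrr.
have szF : (size F <= #|C|.+1)%N.
  by rewrite (leq_trans (size_polyD _ _)) // size_polyN geq_max !(size_coef_prod_linear C x _).1.
have m0 : (0 < #|C|)%N by rewrite (cardsD1 a0) a0C.
have szG : (size G <= #|C|)%N.
  have [->|G0] := eqVneq G 0; first by rewrite size_poly0.
  by move: szF; rewrite FG size_mulX.
have := coef_lagrange x_inj szG.
have -> : G`_#|C|.-1 = t ^+ #|C| - 1.
  rewrite -[X in _ = _ - X](expr1n _ #|C|) -!(size_coef_prod_linear C x _).2 -coefB -/F FG coefMX.
  by case: #|C| m0.
move=> /(congr1 (fun z => - z)) /=; rewrite opprB => ->; rewrite -sumrN big_distrr /=.
apply: eq_bigr => a aC.
have -> : G.[x a] = (t - 1) * \prod_(b in C | b != a) (t * x a - x b).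
  apply: (mulIf (x0 a)); rewrite -[X in G.[_] * X](hornerX (x a)) -hornerM -FG.
  rewrite hornerD hornerN !horner_prod [X in _ - X](bigD1 a) //= linE mul1r subrr mul0r subr0.
  rewrite (bigD1 a) //= linE -[X in _ - X]mul1r -mulrBl mulrAC; congr (_ * _ * _).
  by apply: eq_bigr => b _; rewrite linE.
rewrite -mulrA -[in RHS]mulNr opprB -[in RHS]prodf_div; congr (_ * _).
apply: eq_bigr => b _.
by rewrite -[t * _ - _]opprB -[x a - _]opprB invrN mulrNN.
Qed.

Lemma prod_ord_lift (R : pzSemiRingType) n (F : 'I_n.+1 -> R) :
  \prod_(i < n.+1) F i = (\prod_(i < n) F (lift ord_max i)) * F ord_max.
Proof.
rewrite big_ord_recr; congr (_ * _); apply: eq_bigr => i _; congr F.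
by apply: val_inj; apply: esym (lift_max i).
Qed.

Lemma prod_ltn_lift (R : comPzSemiRingType) n (F : 'I_n.+1 -> 'I_n.+1 -> R) :
  \prod_(i < n.+1) \prod_(j < n.+1 | (i < j)%N) F i j =
  (\prod_(i < n) \prod_(j < n | (i < j)%N) F (lift ord_max i) (lift ord_max j)) *
  \prod_(i < n) F (lift ord_max i) ord_max.
Proof.
rewrite prod_ord_lift [X in _ * X]big_pred0 => [|j]; last first.
  by rewrite ltnNge -ltnS ltn_ord.
rewrite mulr1 -big_split; apply: eq_bigr => i _.
rewrite big_mkcond prod_ord_lift lift_max [(i < ord_max)%N]ltn_ord.
rewrite [in RHS]big_mkcond; congr (_ * _).
by apply: eq_bigr => j _; rewrite lift_max.
Qed.

Lemma prod_lift (R : comPzSemiRingType) n (a : 'I_n.+1) (F : 'I_n.+1 -> R) :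
  \prod_(b | b != a) F b = \prod_(i < n) F (lift a i).
Proof.
rewrite (reindex_omap (lift a) (unlift a)) => [|b]; last first.
  by rewrite eq_sym => /unlift_some[i -> ->].
by apply: eq_bigl => i; rewrite liftK eqxx eq_sym neq_lift.
Qed.

Section OrderSum.
Variables (R : comPzSemiRingType) (T : Type) (psi : T -> T -> R).

Definition order_sum n (y : 'I_n -> T) : R :=
  \sum_(w : 'S_n) \prod_(i < n) \prod_(j < n | (i < j)%N) psi (y (w i)) (y (w j)).

(** Orderings are split by their last element [a]; [lift_perm] matches the rest with orderings of
    the other elements. *)
Lemma order_sumS n (y : 'I_n.+1 -> T) :
  order_sum y =
  \sum_a (\prod_(b | b != a) psi (y b) (y a)) * order_sum (y \o lift a).
Proof.
rewrite /order_sum (partition_big (fun w : 'S_n.+1 => w ord_max) predT) //=.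
apply: eq_bigr => a _; rewrite big_distrr /=.
rewrite (reindex (lift_perm ord_max a)) /=; last first.
  (* The inverse of [lift_perm] deletes the last position and its value; the default [k] is never
     reached since [w] is injective. *)
  pose f (w : 'S_n.+1) k := odflt k (unlift (w ord_max) (w (lift ord_max k))).
  have fE (w : 'S_n.+1) k : lift (w ord_max) (f w k) = w (lift ord_max k).
    rewrite /f; case: unliftP => [//|/perm_inj/eqP].
    by rewrite eq_sym (negbTE (neq_lift _ _)).
  have f_inj w : injective (f w).
    move=> k k' /(congr1 (lift (w ord_max))); rewrite !fE.
    by move=> /perm_inj; apply: lift_inj.
  exists (fun w => perm (@f_inj w)) => [s _|w /eqP wa]; apply/permP => k.
    apply: (@lift_inj _ a); rewrite permE.
    by have := fE (lift_perm ord_max a s) k; rewrite lift_perm_id lift_perm_lift.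
  case: (unliftP ord_max k) => [k'|] ->; last by rewrite lift_perm_id wa.
  by rewrite lift_perm_lift -wa permE fE.
apply: eq_big => [s|s _]; first by rewrite lift_perm_id eqxx.
rewrite prod_ltn_lift mulrC; congr (_ * _).
  rewrite prod_lift [RHS](reindex_inj (@perm_inj _ s)) /=.
  by apply: eq_bigr => i _; rewrite lift_perm_lift lift_perm_id.
by apply: eq_bigr => i _; apply: eq_bigr => j _; rewrite !lift_perm_lift.
Qed.

End OrderSum.

Definition q_factorial (L : fieldType) (t : L) (m : nat) : L :=
  \prod_(1 <= j < m.+1) ((1 - t ^+ j) / (1 - t)).

Section HLOrderSum.
Variables (L : fieldType) (t : L).
Hypothesis t1 : 1 - t != 0.

(** The second component is a label. Constant labels give the full sum over [S_n]; in general the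
    indicator keeps only orderings compatible with the labels, as in a sum over a stabilizer. *)
Definition HL_ker (y z : L * nat) : L :=
  if y.2 == z.2 then (y.1 - t * z.1) / (y.1 - z.1) else (z.2 < y.2)%N%:R.

(* Only orderings with nonincreasing labels contribute, and the last element
   runs over the class of the least label, where [sum_prod_HL] applies. *)
Lemma order_sum_HL n (y : 'I_n -> L * nat) M :
    injective (fst \o y) -> (forall i, (y i).1 != 0) -> (forall i, (y i).2 < M)%N ->
  order_sum HL_ker y = \prod_(v < M) q_factorial t #|[set i | (y i).2 == v]|.
Proof.
elim: n y => [|n IHn] y y_inj y0 yM.
  rewrite /order_sum (bigD1 1%g) //= big_ord0 big1 ?addr0 => [|w /eqP[]]; last first.
    by apply/permP => -[].
  by rewrite big1 // => v _; rewrite eq_card0 ?/q_factorial ?big_geq // => -[].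
rewrite order_sumS.
have [a0 _ a0min] := arg_minnP (fun i => (y i).2) (erefl (xpredT (@ord0 n))).
pose c := (y a0).2; pose C := [set i | (y i).2 == c].
rewrite (bigID (mem C)) /= [X in _ + X]big1 ?addr0 => [|a]; last first.
  rewrite inE => ac; rewrite (bigD1 a0) /=; last by apply: contraNneq ac => <-.
  rewrite /HL_ker -/c eq_sym (negbTE ac) ltnNge (a0min a isT) /=.
  by rewrite !mul0r.
have cM : (c < M)%N by apply: yM.
pose d := Ordinal cM.
transitivity (\sum_(a in C) (\prod_(b in C | b != a) (((y b).1 - t * (y a).1) / ((y b).1 - (y a).1)))
   * (q_factorial t #|C|.-1 * \prod_(v < M | v != d) q_factorial t #|[set i | (y i).2 == v]|)).
  apply: eq_bigr => a aC; congr (_ * _).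
    rewrite [LHS]big_mkcond [RHS]big_mkcond /=; apply: eq_bigr => b _.
    move: aC; rewrite !inE /HL_ker => /eqP ->.
    case: (b == a); rewrite ?andbF // andbT; case: eqP => // /eqP bc.
    by rewrite ltn_neqAle eq_sym bc a0min.
  rewrite IHn; [|exact: inj_comp y_inj (@lift_inj _ a)|by move=> i; apply: y0|by move=> i; apply: yM].
  have cardE v : (#|[set i | (y i).2 == v]| =
     ((y a).2 == v) + #|[set i | ((y \o lift a) i).2 == v]|)%N.
    rewrite (cardsD1 a) inE; congr (_ + _)%N.
    rewrite -(card_imset _ (@lift_inj _ a)); apply: eq_card => b; rewrite !inE.
    case: (unliftP a b) => [i ->|->].
      by rewrite mem_imset ?inE ?[lift a i == a]eq_sym ?neq_lift //; apply: lift_inj.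
    rewrite eqxx; apply/esym/negP => /imsetP[i _ /eqP].
    by rewrite (negbTE (neq_lift _ _)).
  move: aC; rewrite inE => /eqP ac.
  rewrite (bigD1 d) //= {1}/C cardE ac eqxx /=; congr (_ * _).
  by apply: eq_bigr => v vd; rewrite cardE ac -[c]/(val d) eq_sym val_eqE (negbTE vd).
rewrite -big_distrl /= [RHS](bigD1 d) //= mulrA; congr (_ * _).
rewrite -[[set _ | _]]/C.
have : (0 < #|C|)%N by rewrite (cardsD1 a0) inE eqxx.
move: #|C| (@sum_prod_HL _ _ C (fst \o y) t (in2W y_inj) y0) => [//|m] /= e _.
rewrite {2}/q_factorial big_nat_recr //= -/(q_factorial _ _) mulrC; congr (_ * _).
by apply: (mulfI t1); rewrite e mulrC divfK.
Qed.

End HLOrderSum.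

(** * Alternating polynomials *)

Section Vandermonde.
Variables (R : idomainType) (N : nat).
Implicit Types (i j k : 'I_N) (p q : {mpoly R[N]}).

Definition vdm : {mpoly R[N]} := \prod_(i < N) \prod_(j < N | (i < j)%N) ('X_i - 'X_j).

(** This orientation is the one of [det_Vandermonde], and [vdm * vdm_rev] runs over all ordered
    pairs, hence is symmetric. *)
Definition vdm_rev : {mpoly R[N]} := \prod_(i < N) \prod_(j < N | (i < j)%N) ('X_j - 'X_i).

Lemma subXX_neq0 i j : i != j -> 'X_i - 'X_j != 0 :> {mpoly R[N]}.
Proof.
move=> ij; apply/eqP => /(congr1 (mcoeff U_(i))) /eqP.
by rewrite mcoeffB !mcoeffXU eqxx [j == i]eq_sym (negbTE ij) subr0 mcoeff0 oner_eq0.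
Qed.

Lemma vdm_neq0 : vdm != 0.
Proof.
apply/prodf_neq0 => i _; apply/prodf_neq0 => j ij.
by rewrite subXX_neq0 // neq_ltn ij.
Qed.

Lemma vdm_rev_neq0 : vdm_rev != 0.
Proof.
apply/prodf_neq0 => i _; apply/prodf_neq0 => j ij.
by rewrite subXX_neq0 // neq_ltn ij orbT.
Qed.

(** Permuting the variables permutes the columns of the Vandermonde matrix. *)
Lemma msym_vdm_rev (s : 'S_N) : msym s vdm_rev = (-1) ^+ s *: vdm_rev.
Proof.
pose a : 'rV[{mpoly R[N]}]_N := \row_i 'X_i.
have vdmE : vdm_rev = \det (Vandermonde N a).
  rewrite det_Vandermonde; apply: eq_bigr => i _; apply: eq_bigr => j _.
  by rewrite !mxE.
rewrite vdmE -det_map_mx.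
have -> : map_mx (msym s) (Vandermonde N a) = col_perm s (Vandermonde N a).
  apply/matrixP => i j; rewrite !mxE rmorphXn /=; congr (_ ^+ _).
  rewrite msymX; congr mpolyX; apply/mnmP => k; rewrite mnmE !mnm1E.
  by rewrite (canF_eq (permK s)).
rewrite col_permE det_mulmx det_perm odd_permV mulrC.
by rewrite -mul_mpolyC rmorph_sign.
Qed.

Definition identify i j p : {mpoly R[N]} :=
  p \mPo [tuple if k == i then 'X_j else 'X_k | k < N].

Lemma identify_sub i j p : exists q, p - identify i j p = ('X_i - 'X_j) * q.
Proof.
pose P p := exists q, p - identify i j p = ('X_i - 'X_j) * q; rewrite -/(P p).
have PD p1 p2 : P p1 -> P p2 -> P (p1 + p2).
  move=> [q1 e1] [q2 e2]; exists (q1 + q2).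
  by rewrite /identify raddfD /= opprD addrACA -!/(identify _ _ _) e1 e2 mulrDr.
have PM p1 p2 : P p1 -> P p2 -> P (p1 * p2).
  move=> [q1 e1] [q2 e2]; exists (q1 * p2 + identify i j p1 * q2).
  rewrite mulrDr mulrA -e1 mulrCA -e2 /identify rmorphM /=.
  by rewrite mulrBl mulrBr addrA subrK.
have P1 : P 1 by exists 0; rewrite /identify rmorph1 subrr mulr0.
have PX k : P 'X_k.
  rewrite /P /identify comp_mpolyXU -tnth_nth tnth_mktuple.
  case: eqP => [->|_]; first by exists 1; rewrite mulr1.
  by exists 0; rewrite subrr mulr0.
have PXn k e : P ('X_k ^+ e).
  by elim: e => [|e IHe]; [exact: P1 | rewrite exprS; exact: PM (PX k) IHe].
elim/mpolyind: p => [|c m p _ _ Pp].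
  by exists 0; rewrite /identify raddf0 subrr mulr0.
apply: PD Pp; rewrite -mul_mpolyC; apply: (PM).
  by exists 0; rewrite /identify comp_mpolyC subrr mulr0.
rewrite mpolyXE_id; apply: (big_ind P P1 PM) => k _.
exact: PXn.
Qed.

(** Factors are extracted one pair at a time. Setting [x_i := x_j] kills none of the factors already
    extracted, so by integrality it kills the cofactor [q], and [identify_sub] applies to [q]. *)
Lemma dvd_vdm p : (forall i j, (i < j)%N -> identify i j p = 0) -> exists q, p = vdm * q.
Proof.
move=> p0; have -> : vdm = \prod_(u <- [seq u : 'I_N * 'I_N <- index_enum _ | (u.1 < u.2)%N])
    ('X_u.1 - 'X_u.2).
  by rewrite big_filter /vdm pair_big_dep.
have : all (fun u : 'I_N * 'I_N => (u.1 < u.2)%N)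
    [seq u : 'I_N * 'I_N <- index_enum _ | (u.1 < u.2)%N].
  exact: filter_all.
have : uniq [seq u : 'I_N * 'I_N <- index_enum _ | (u.1 < u.2)%N].
  by rewrite filter_uniq ?index_enum_uniq.
elim: [seq u <- _ | _] => [|[i j] s IHs] /=; first by exists p; rewrite big_nil mul1r.
move=> /andP[ijs us] /andP[ij sP]; have [q pE] := IHs us sP.
have := p0 i j ij; rewrite pE /identify rmorphM /= => /eqP; rewrite mulf_eq0 => /orP[|/eqP q0].
  rewrite rmorph_prod /= prodf_seq_eq0 => /hasP[[k l] kls] /=.
  have kl := allP sP _ kls; rewrite /= in kl.
  rewrite rmorphB /= !comp_mpolyXU -!tnth_nth !tnth_mktuple.
  have klij : (k, l) != (i, j) by apply: contraNneq ijs => <-.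
  (* Setting [x_i := x_j] merges [k < l] only if [{k, l} = {i, j}], which [klij] excludes. *)
  suff ff : (if k == i then j else k) != (if l == i then j else l).
    by rewrite -2!(fun_if (fun x : 'I_N => 'X_x)) (negbTE (subXX_neq0 ff)).
  case: (k =P i) => [ki|_]; case: (l =P i) => [li|_].
  - by rewrite ki li ltnn in kl.
  - by apply: contraNneq klij => ->; rewrite ki.
  - by apply/eqP => kj; move: ij; rewrite ltnNge -kj -li ltnW.
  - by rewrite neq_ltn kl.
have [r rE] := identify_sub i j q; rewrite /identify q0 subr0 in rE.
by exists r; rewrite big_cons rE /= mulrCA mulrA.
Qed.

(** Exchanging [x_i] and [x_j] negates [p] but is invisible once [x_i := x_j], so twice the
    substituted polynomial is 0. *)
Lemma dvd_vdm_alt p : 2%:R != 0 :> R ->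
  (forall s : 'S_N, msym s p = (-1) ^+ s *: p) -> exists q, p = vdm * q.
Proof.
move=> R2 alt; apply: dvd_vdm => i j ij.
have /(congr1 (identify i j)) := alt (tperm i j).
rewrite odd_tperm neq_ltn ij expr1 scaleN1r.
have -> : identify i j (msym (tperm i j) p) = identify i j p.
  rewrite /identify msym_mPo; congr (_ \mPo _); apply: eq_from_tnth => k.
  rewrite !tnth_mktuple; case: tpermP => [->|->|//]; rewrite ?eqxx ?if_same //.
move/eqP; rewrite /identify raddfN -addr_eq0 -mulr2n -scaler_nat mscalerI.
by rewrite (negbTE R2) => /eqP.
Qed.

End Vandermonde.

(** * Hall-Littlewood polynomials *)

Lemma prod_neq_ltn (A : comPzSemiRingType) N (F : 'I_N -> 'I_N -> A) :
  \prod_i \prod_(j | j != i) F i j = \prod_(i < N) \prod_(j < N | (i < j)%N) (F i j * F j i).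
Proof.
under [RHS]eq_bigr do rewrite big_split.
rewrite big_split /= [X in _ = _ * X](exchange_big_dep predT) //= -big_split.
apply: eq_bigr => i _; rewrite (bigID (fun j : 'I_N => (i < j)%N)) /=.
congr (_ * _); apply: eq_bigl => j; rewrite neq_ltn.
  by case: ltngtP.
by case: ltngtP.
Qed.

Lemma prod_neq_perm (A : comPzSemiRingType) N (F : 'I_N -> 'I_N -> A) (s : 'S_N) :
  \prod_i \prod_(j | j != i) F (s i) (s j) = \prod_i \prod_(j | j != i) F i j.
Proof.
rewrite [RHS](reindex_inj (@perm_inj _ s)); apply: eq_bigr => i _.
rewrite [RHS](reindex_inj (@perm_inj _ s)); apply: eq_bigl => j.
by rewrite (inj_eq perm_inj).
Qed.

Lemma perm_map_enum (T : finType) (s : {perm T}) :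
  perm_eq [seq s i | i <- enum T] (enum T).
Proof.
apply: uniq_perm (enum_uniq _) _ => [|i].
  by rewrite (map_inj_uniq (@perm_inj _ s)) enum_uniq.
by rewrite mem_enum; apply/mapP; exists ((s^-1)%g i); rewrite ?mem_enum ?permKV.
Qed.

(** * The numerator as a sum over labellings *)

Section Numerator.
Variable la : seq nat.

(** The bound [sumn la] on the labels exceeds no part and makes the type finite, so that one can sum
    over it. *)
Definition labelling N := {ffun 'I_N -> 'I_(sumn la).+1}.

(* The nonzero labels are the parts of la, with multiplicity. *)
Definition has_content N (g : labelling N) : bool :=
  perm_eq [seq v <- [seq val (g i) | i <- enum 'I_N] | v != 0%N] la.

(** This is [x i - x j] times the Hall-Littlewood factor of the pair; when [g i < g j] that factor
    is [(x j - t * x i) / (x j - x i)], whence [t * x i - x j]. *)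
Definition HL_fac (A : pzRingType) (t : A) N (x : 'I_N -> A) (g : labelling N) i j : A :=
  if g i == g j then x i - x j else
  if (g j < g i)%N then x i - t * x j else t * x i - x j.

(* [prod_(i < j) (x i - x j)] times the sum over the distinct rearrangements
   g of la of [x^g prod_(g i > g j) (x i - t * x j) / (x i - x j)], which is
   P_la(x; t). *)
Definition HL_num (A : comNzRingType) (t : A) N (x : 'I_N -> A) : A :=
  \sum_(g : labelling N | has_content g)
    (\prod_i x i ^+ g i) * \prod_(i < N) \prod_(j < N | (i < j)%N) HL_fac t x g i j.

(** Generality in the ring lets one lemma serve variable permutations, [drop_var], [tofrac] and
    evaluation. *)
Lemma rmorph_HL_num (A B : comNzRingType) (f : {rmorphism A -> B}) (t : A) N (x : 'I_N -> A) :
  f (HL_num t x) = HL_num (f t) (f \o x).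
Proof.
rewrite rmorph_sum; apply: eq_bigr => g _; rewrite rmorphM !rmorph_prod.
congr (_ * _); apply: eq_bigr => i _; first by rewrite rmorphXn.
rewrite rmorph_prod; apply: eq_bigr => j _; rewrite /HL_fac.
by case: ifP => _; [|case: ifP => _]; rewrite rmorphB ?rmorphM.
Qed.

Lemma eq_HL_num (A : comNzRingType) (t : A) N (x y : 'I_N -> A) :
  x =1 y -> HL_num t x = HL_num t y.
Proof.
move=> xy; apply: eq_bigr => g _; congr (_ * _); apply: eq_bigr => i _.
  by rewrite xy.
by apply: eq_bigr => j _; rewrite /HL_fac !xy.
Qed.

(** The right-hand side ignores the order of the indices, so permuting the points only reindexes the
    labellings; [HL_num_perm] rests on this. *)
Lemma HL_num_sym (A : comNzRingType) (t : A) N (x : 'I_N -> A) :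
  HL_num t x * \prod_(i < N) \prod_(j < N | (i < j)%N) (x j - x i) =
  \sum_(g : labelling N | has_content g) (\prod_i x i ^+ g i) *
    \prod_i \prod_(j | j != i) (if (g j < g i)%N then x i - t * x j else x i - x j).
Proof.
rewrite big_distrl; apply: eq_bigr => g _ /=; rewrite -mulrA; congr (_ * _).
rewrite prod_neq_ltn -big_split; apply: eq_bigr => i _; rewrite -big_split.
apply: eq_bigr => j _ /=; rewrite /HL_fac -val_eqE /=.
by case: (ltngtP (g i) (g j)) => _ //; ring.
Qed.

Lemma HL_num_perm (A : comNzRingType) (t : A) N (x : 'I_N -> A) (s : 'S_N) :
  let y := x \o s in
  HL_num t y * \prod_(i < N) \prod_(j < N | (i < j)%N) (y j - y i) =
  HL_num t x * \prod_(i < N) \prod_(j < N | (i < j)%N) (x j - x i).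
Proof.
move=> y; rewrite !HL_num_sym.
pose gs (g : labelling N) : labelling N := [ffun i => g (s i)].
have gs_inj : injective gs.
  move=> g h /ffunP gh; apply/ffunP => i.
  by have := gh ((s^-1)%g i); rewrite !ffunE permKV.
have perm_labels (g : labelling N) :
    perm_eq [seq val (gs g i) | i <- enum 'I_N] [seq val (g i) | i <- enum 'I_N].
  under eq_map do rewrite ffunE; rewrite (map_comp (val \o g) s); apply: perm_map.
  exact: perm_map_enum.
rewrite [LHS](reindex_inj gs_inj) /=; apply: eq_big => [g|g _].
  by rewrite /has_content (permPl (perm_filter _ (perm_labels g))).
congr (_ * _).
  rewrite [RHS](reindex_inj (@perm_inj _ s)).
  by apply: eq_bigr => i _; rewrite ffunE.
rewrite -[RHS](prod_neq_perm _ s); apply: eq_bigr => i _; apply: eq_bigr => j _.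
by rewrite !ffunE.
Qed.

(** The zero coordinate kills every labelling with a nonzero last label, and the others are
    extensions of labellings of the first [N] indices. *)
Lemma HL_num_lift (A : comNzRingType) (t : A) N (x : 'I_N.+1 -> A) (y : 'I_N -> A) :
    x ord_max = 0 -> (forall i, x (lift ord_max i) = y i) ->
  HL_num t x = HL_num t y * \prod_i y i.
Proof.
move=> x0 xy; pose ext (g : labelling N) : labelling N.+1 :=
  [ffun i => if unlift ord_max i is Some j then g j else ord0].
pose res (g : labelling N.+1) : labelling N := [ffun j => g (lift ord_max j)].
have ext_lift g j : ext g (lift ord_max j) = g j by rewrite ffunE liftK.
have ext_max g : ext g ord_max = ord0 by rewrite ffunE unlift_none.
rewrite /HL_num (bigID (fun g : labelling N.+1 => g ord_max == ord0)) /=.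
rewrite [X in _ + X]big1 ?addr0 => [|g /andP[_ gmax]]; last first.
  rewrite (bigD1 ord_max) //= x0 expr0n.
  by move: gmax; rewrite -val_eqE /= => /negbTE ->; rewrite !mul0r.
rewrite (reindex_onto ext res) => [|g /andP[_ /eqP gmax]]; last first.
  by apply/ffunP => i; rewrite ffunE; case: unliftP => [j|] ->; rewrite ?ffunE.
rewrite big_distrl /=; apply: eq_big => [g|g _].
  rewrite ext_max eqxx andbT.
  have -> : res (ext g) == g by apply/eqP/ffunP => j; rewrite ffunE ext_lift.
  rewrite andbT; congr (perm_eq _ _).
  have -> : enum 'I_N.+1 = rcons [seq lift ord_max j | j <- enum 'I_N] ord_max.
    apply: (inj_map val_inj); rewrite map_rcons -[in RHS]map_comp.
    transitivity (rcons [seq val i | i <- enum 'I_N] N).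
      by rewrite !val_enum_ord -addn1 iotaD cats1.
    by congr rcons; apply: eq_map => i; apply: esym (lift_max i).
  rewrite map_rcons filter_rcons ext_max /= -map_comp.
  by congr filter; apply: eq_map => j /=; rewrite ext_lift.
rewrite prod_ord_lift x0 ext_max expr0 mulr1 prod_ltn_lift mulrA.
congr (_ * _ * _); first by apply: eq_bigr => i _; rewrite ext_lift xy.
  by apply: eq_bigr => i _; apply: eq_bigr => j _; rewrite /HL_fac !ext_lift !xy.
(* With [x ord_max = 0], the factor at [(i, ord_max)] is [y i] whether or not the label of [i] is
   0. *)
apply: eq_bigr => i _; rewrite /HL_fac ext_lift ext_max x0 xy mulr0 !subr0.
rewrite -val_eqE /= lt0n; by case: eqP.
Qed.

End Numerator.

Lemma dhomog_bigprod (R : nzRingType) N (I : Type) (r : seq I) (P : pred I)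
    (F : I -> {mpoly R[N]}) (d : I -> nat) :
  (forall i, P i -> F i \is (d i).-homog) ->
  \prod_(i <- r | P i) F i \is (\sum_(i <- r | P i) d i)%N.-homog.
Proof.
move=> hF; apply: (big_rec2 (fun p e => p \is e.-homog)) => [|i e p /hF].
  exact: dhomog1.
exact: dhomogM.
Qed.

(** [p] times the component of [q] of degree [k] is the component of [p * q] of degree [e + k],
    which is 0 for [k != d]. *)
Lemma dhomog_cancel (R : idomainType) N (p q : {mpoly R[N]}) d e :
  p != 0 -> p \is e.-homog -> p * q \is (e + d).-homog -> q \is d.-homog.
Proof.
move=> p0 hp hpq; rewrite homog_piE; apply/eqP.
have pi0 k : k != d -> pihomog mdeg k q = 0.
  move=> kd; have : pihomog mdeg (e + k) (p * q) = 0.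
    by apply: pihomog_ne0 hpq; rewrite eqn_add2l eq_sym.
  (* The maximum makes degree [k] occur in the decomposition even beyond the degree of [q]. *)
  have szq : (msize q <= maxn (msize q) k.+1)%N by apply: leq_maxl.
  have kK : (k < maxn (msize q) k.+1)%N by apply: leq_maxr.
  rewrite {1}(pihomog_partitionE szq) big_distrr linear_sum (bigD1 (Ordinal kK)) //=.
  rewrite big1 ?addr0 => [|l lk]; last first.
    apply: (@pihomog_ne0 _ _ mdeg (e + l)); first by rewrite eqn_add2l.
    exact: dhomogM hp (pihomogP _ _ _).
  rewrite pihomog_dE; last exact: dhomogM hp (pihomogP _ _ _).
  by move/eqP; rewrite mulf_eq0 (negbTE p0) => /eqP.
have szq : (msize q <= maxn (msize q) d.+1)%N by apply: leq_maxl.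
have dK : (d < maxn (msize q) d.+1)%N by apply: leq_maxr.
rewrite [RHS](pihomog_partitionE szq) (bigD1 (Ordinal dK)) //= big1 ?addr0 // => l lk.
exact: pi0.
Qed.

Lemma has_content_sum la N (g : labelling la N) :
  has_content g -> (\sum_i g i = sumn la)%N.
Proof.
move=> /perm_sumn sumE; apply: etrans sumE; rewrite [RHS]sumnE.
rewrite big_filter big_map big_enum_cond [RHS]big_mkcond /=.
by apply: eq_bigr => i _; case: eqP.
Qed.

(** * The quotient polynomials and their stability *)

Section HLPolynomial.
Variables (la : seq nat) (N : nat).

Local Notation R := {poly int}.
Local Notation t := ('X%:MP : {mpoly R[N]}).
Local Notation X := (fun i : 'I_N => 'X_i : {mpoly R[N]}).

(** The product with [vdm_rev] is symmetric and [vdm_rev] is alternating; cancel it. *)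
Lemma HL_num_alt (s : 'S_N) : msym s (HL_num la t X) = (-1) ^+ s *: HL_num la t X.
Proof.
have eX i : msym s 'X_i = 'X_(s i) :> {mpoly R[N]} by rewrite /msym mmapX mmap1U.
have eH : msym s (HL_num la t X) = HL_num la t (X \o s).
  have et : msym s t = t by rewrite /msym mmapC.
  by rewrite -[in RHS]et rmorph_HL_num; apply: eq_HL_num => i; exact: eX.
have eV : msym s (vdm_rev R N) =
    \prod_(i < N) \prod_(j < N | (i < j)%N) ((X \o s) j - (X \o s) i).
  rewrite rmorph_prod; apply: eq_bigr => i _; rewrite rmorph_prod.
  by apply: eq_bigr => j _; rewrite rmorphB /= !eX.
have eHV : msym s (HL_num la t X) * msym s (vdm_rev R N) = HL_num la t X * vdm_rev R N.
  by rewrite eH eV; apply: HL_num_perm.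
apply: (mulIf (vdm_rev_neq0 R N)).
rewrite -scalerAl -eHV msym_vdm_rev -scalerAr scalerA.
by rewrite -signr_addb addbb scale1r.
Qed.

Lemma HL_num_dvd : exists q, HL_num la t X = vdm R N * q.
Proof. by apply: dvd_vdm_alt HL_num_alt; rewrite -polyC_natr polyC_eq0. Qed.

Definition HL_poly : {mpoly R[N]} := sval (cid HL_num_dvd).

Lemma vdm_HL_poly : vdm R N * HL_poly = HL_num la t X.
Proof. by rewrite /HL_poly; case: cid. Qed.

(** Times the symmetric [vdm * vdm_rev] it becomes [HL_num * vdm_rev], a product of two alternating
    polynomials. *)
Lemma HL_poly_sym : HL_poly \is symmetric.
Proof.
have D0 : vdm R N * vdm_rev R N != 0 by rewrite mulf_neq0 ?vdm_neq0 ?vdm_rev_neq0.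
apply: (msymMK D0).
  apply/issymP => s; rewrite /vdm /vdm_rev -big_split.
  under eq_bigr do rewrite -big_split.
  rewrite -(prod_neq_ltn (fun i j : 'I_N => 'X_i - 'X_j : {mpoly R[N]})).
  rewrite -[RHS](prod_neq_perm _ s) rmorph_prod; apply: eq_bigr => i _.
  rewrite rmorph_prod; apply: eq_bigr => j _.
  by rewrite rmorphB /= /msym !mmapX !mmap1U.
rewrite mulrAC vdm_HL_poly; apply/issymP => s.
by rewrite rmorphM /= msym_vdm_rev HL_num_alt -scalerAl -scalerAr scalerA -signr_addb addbb scale1r.
Qed.

Lemma homog_subXX (i j : 'I_N) (a b : {poly int}) :
  a%:MP * 'X_i - b%:MP * 'X_j \is [in R[N], 1.-homog].
Proof.
by rewrite !mul_mpolyC; apply: rpredB; apply: rpredZ; rewrite dhomogX; apply/eqP/mdeg1.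
Qed.

Lemma HL_poly_homog : HL_poly \is (sumn la).-homog.
Proof.
apply: (@dhomog_cancel _ _ (vdm R N) _ _ (\sum_(i < N) \sum_(j < N | (i < j)%N) 1)%N).
- exact: vdm_neq0.
- apply: dhomog_bigprod => i _; apply: dhomog_bigprod => j _.
  by have := homog_subXX i j 1 1; rewrite !mul1r.
rewrite vdm_HL_poly; apply: rpred_sum => g /has_content_sum gsum.
rewrite addnC -[X in (X + _)%N]gsum; apply: dhomogM.
  apply: dhomog_bigprod => i _; rewrite -[X in X.-homog]mul1n; apply: dhomogMn.
  by rewrite dhomogX; apply/eqP/mdeg1.
apply: dhomog_bigprod => i _; apply: dhomog_bigprod => j _; rewrite /HL_fac.
case: ifP => _; first by have := homog_subXX i j 1 1; rewrite !mul1r.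
case: ifP => _; first by have := homog_subXX i j 1 'X; rewrite !mul1r.
by have := homog_subXX i j 'X 1; rewrite !mul1r.
Qed.

End HLPolynomial.

(** Setting the last variable to 0 multiplies both the Vandermonde product and, by [HL_num_lift],
    the numerator by the product of the remaining variables. *)
Lemma drop_var_HL_poly la N : drop_var (HL_poly la N.+1) = HL_poly la N.
Proof.
pose P := \prod_i 'X_i : {mpoly {poly int}[N]}.
have P0 : P != 0 by apply/prodf_neq0 => i _; rewrite -msupp_eq0 msuppX.
have dropX (i : 'I_N.+1) : drop_var ('X_i : {mpoly {poly int}[N.+1]}) =
    if unlift ord_max i is Some j then 'X_j else 0.
  by rewrite /drop_var comp_mpolyXU -tnth_nth tnth_mktuple.
have dropXl j : drop_var ('X_(lift ord_max j) : {mpoly {poly int}[N.+1]}) = 'X_j.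
  by rewrite dropX liftK.
have dropXm : drop_var ('X_ord_max : {mpoly {poly int}[N.+1]}) = 0.
  by rewrite dropX unlift_none.
apply: (mulfI (mulf_neq0 (vdm_neq0 _ N) P0)); rewrite [RHS]mulrAC vdm_HL_poly.
transitivity (drop_var (vdm {poly int} N.+1 * HL_poly la N.+1)).
  rewrite [RHS]rmorphM /=; congr (_ * _); rewrite /vdm prod_ltn_lift rmorphM /=.
  rewrite !rmorph_prod; congr (_ * _); apply: eq_bigr => i _.
    rewrite rmorph_prod; apply: eq_bigr => j _; rewrite rmorphB /=.
    by congr (_ - _); rewrite -[LHS]dropXl.
  by rewrite rmorphB /= -[LHS]subr0; congr (_ - _); [rewrite -[LHS]dropXl|rewrite -[LHS]dropXm].
rewrite vdm_HL_poly.
have -> : drop_var (HL_num la ('X%:MP) (fun i : 'I_N.+1 => 'X_i : {mpoly {poly int}[N.+1]})) =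
    HL_num la ('X%:MP) (fun i : 'I_N.+1 => drop_var 'X_i).
  rewrite /drop_var; set T := mktuple _.
  by rewrite -[in RHS](comp_mpolyC 'X T) (rmorph_HL_num la (comp_mpoly T)).
apply: (HL_num_lift la 'X%:MP _ dropXl).
exact: dropXm.
Qed.

Lemma msize_dhomog (R : nzRingType) N d (p : {mpoly R[N]}) :
  p \is d.-homog -> (msize p <= d.+1)%N.
Proof.
by move/dhomogP => hp; rewrite msizeE; apply/bigmax_leqP_seq => m /hp -> _.
Qed.

Lemma HL_sym_subproof la : (fun N => HL_poly la N) \in @symfun_pred {poly int}.
Proof.
apply/asboolP; split=> [N|N|]; [exact: HL_poly_sym|exact: drop_var_HL_poly|].
by exists (sumn la).+1 => N; apply/msize_dhomog/HL_poly_homog.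
Qed.

(** This element witnesses the existence left open by the definition of [HL_P]. *)
Definition HL_sym la : symfun {poly int} := SymFun (HL_sym_subproof la).

Lemma perm_eq_nonzero (s1 s2 : seq nat) : size s1 = size s2 ->
  perm_eq [seq v <- s1 | v != 0%N] [seq v <- s2 | v != 0%N] -> perm_eq s1 s2.
Proof.
pose nz := fun v : nat => v != 0%N; move=> sz12 nz12.
have zeros s : [seq v <- s | predC nz v] = nseq (size s - size [seq v <- s | nz v]) 0%N.
  rewrite !size_filter -(count_predC nz s) addKn -size_filter.
  by apply/all_pred1P/allP => v; rewrite mem_filter /= negbK => /andP[].
rewrite -(permPl (permEl (perm_filterC nz s1))) -(permPr (permEl (perm_filterC nz s2))).
by rewrite !zeros sz12 (perm_size nz12) perm_cat2r.
Qed.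

Lemma map_HL_part la N : (size la <= N)%N ->
  [seq HL_part la i | i <- enum 'I_N] = la ++ nseq (N - size la) 0%N.
Proof.
move=> leN; rewrite (map_comp (nth 0%N la) val) val_enum_ord -{1}(subnKC leN) iotaD map_cat.
congr (_ ++ _); first by rewrite -/(mkseq _ _) mkseq_nth.
apply: (@eq_from_nth _ 0%N); rewrite size_map size_iota ?size_nseq // => i ilt.
by rewrite (nth_map 0%N) ?size_iota // nth_iota // nth_nseq ilt nth_default ?leq_addr.
Qed.

Lemma has_contentP la N (g : labelling la N) : 0%N \notin la -> (size la <= N)%N ->
  has_content g = perm_eq [seq val (g i) | i <- enum 'I_N] [seq HL_part la i | i <- enum 'I_N].
Proof.
move=> la0 leN.
have filter_la : [seq v <- [seq HL_part la i | i <- enum 'I_N] | v != 0%N] = la.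
  rewrite map_HL_part // filter_cat [X in _ ++ X](_ : _ = [::]) ?cats0.
    by apply/all_filterP/allP => v vla; apply: contraNneq la0 => <-.
  by apply/eqP; rewrite -size_eq0 size_filter count_nseq /= mul0n.
apply/idP/idP => [h|h].
  by apply: perm_eq_nonzero; rewrite ?size_map // filter_la.
by rewrite /has_content -[X in perm_eq _ X]filter_la perm_filter.
Qed.

Lemma count_mem_map (T : finType) (U : eqType) (f : T -> U) v :
  count_mem v [seq f i | i <- enum T] = #|[pred i | f i == v]|.
Proof. by rewrite count_map -sum1_card -sum1_count big_enum_cond. Qed.

Lemma card_content la N (g : labelling la N) v : 0%N \notin la -> (size la <= N)%N ->
  has_content g -> #|[set i | val (g i) == v]| = HL_mult la N v.
Proof.
move=> la0 leN; rewrite has_contentP // => /seq.permP e.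
by rewrite cardsE -count_mem_map e count_mem_map.
Qed.

Lemma HL_part_geq la N (i j : 'I_N) : sorted geq la -> (i <= j)%N ->
  (HL_part la j <= HL_part la i)%N.
Proof.
move=> sla ij; rewrite /HL_part; have [jla|jla] := ltnP j (size la); last first.
  by rewrite nth_default.
by apply: (sorted_leq_nth (rev_trans leq_trans) leqnn) => //; rewrite inE ?(leq_ltn_trans ij).
Qed.

Lemma HL_part_le la N (i : 'I_N) : (HL_part la i < (sumn la).+1)%N.
Proof.
rewrite ltnS /HL_part; have [ila|ila] := ltnP i (size la); last by rewrite nth_default.
by rewrite sumnE (big_nth 0%N) big_mkord (bigD1 (Ordinal ila)) //= leq_addr.
Qed.

Lemma HL_multE la N v : (size la <= N)%N ->
  HL_mult la N v = if v == 0%N then (count_mem 0%N la + (N - size la))%N else count_mem v la.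
Proof.
move=> leN; rewrite /HL_mult -(count_mem_map (@HL_part la N)) map_HL_part //.
rewrite count_cat count_nseq /= eq_sym; case: eqP => [->|_]; first by rewrite mul1n.
by rewrite addn0.
Qed.

Lemma sum_HL_mult la N : (\sum_(v < (sumn la).+1) HL_mult la N v = N)%N.
Proof.
rewrite -[RHS]card_ord -sum1_card.
rewrite (partition_big (fun i : 'I_N => inord (HL_part la i) : 'I_(sumn la).+1) predT) //=.
apply: eq_bigr => v _; rewrite /HL_mult -sum1_card; apply: eq_bigl => i.
by rewrite inE -val_eqE /= inordK // HL_part_le.
Qed.

(** * Comparison with the sum over [S_N] *)

Section Symmetrization.
Variables (L : fieldType) (t : L) (la : seq nat) (N : nat) (x : 'I_N -> L).
Hypotheses (t1 : 1 - t != 0) (x_inj : injective x) (x0 : forall i, x i != 0).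
Hypotheses (la_sorted : sorted geq la) (la0 : 0%N \notin la) (leN : (size la <= N)%N).

Local Notation psi i j := ((x i - t * x j) / (x i - x j)).
Local Notation y g := (fun i => (x i, val (g i))).

(** Two nonincreasing lists with the same content are equal. *)
Lemma content_sorted (g : labelling la N) (w : 'S_N) : has_content g ->
    (forall i j : 'I_N, (i < j)%N -> (g (w j) <= g (w i))%N) ->
  forall i, val (g (w i)) = HL_part la i.
Proof.
move=> gla gw_geq.
suff /eq_in_map h : [seq val (g (w i)) | i <- enum 'I_N] = [seq HL_part la i | i <- enum 'I_N].
  by move=> i; apply: h; rewrite mem_enum.
have sorted_ord (f : 'I_N -> nat) : (forall i j : 'I_N, (i < j)%N -> (f j <= f i)%N) ->
    sorted geq [seq f i | i <- enum 'I_N].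
  move=> fge; rewrite sorted_map; apply: (@sub_sorted _ (relpre val ltn)) => [i j|].
    exact: fge.
  by rewrite -sorted_map val_enum_ord iota_ltn_sorted.
apply: (@sorted_eq _ geq); [exact: rev_trans leq_trans| | | |].
- by move=> m n /andP[mn nm]; apply/eqP; rewrite eqn_leq; apply/andP; split.
- exact: sorted_ord.
- by apply: sorted_ord => i j /ltnW; apply: HL_part_geq.
apply: perm_trans (_ : perm_eq [seq val (g i) | i <- enum 'I_N] _).
  by rewrite (map_comp (val \o g) w); apply/perm_map/perm_map_enum.
by rewrite -has_contentP.
Qed.

Lemma order_prod_neq0 n (y : 'I_n -> L * nat) :
    \prod_(i < n) \prod_(j < n | (i < j)%N) HL_ker t (y i) (y j) != 0 ->
  forall i j : 'I_n, (i < j)%N -> ((y j).2 <= (y i).2)%N.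
Proof.
move=> nz i j ij; rewrite leqNgt; apply: contra nz => gij; apply/eqP.
rewrite (bigD1 i) //= (bigD1 j) //= /HL_ker /= ltn_eqF // ltnNge ltnW //=.
by rewrite !mul0r.
Qed.

Lemma order_sum_labels (g : labelling la N) : has_content g ->
  order_sum (HL_ker t) (y g) = \prod_(v < (sumn la).+1) q_factorial t (HL_mult la N v).
Proof.
move=> gla.
rewrite (@order_sum_HL _ _ t1 _ _ (sumn la).+1); [|exact: x_inj|exact: x0|by move=> i /=].
by apply: eq_bigr => v _; rewrite -(card_content v la0 leN gla).
Qed.

(** An ordering with nonzero product lists the labels in nonincreasing order, hence spells [la]; so
    the restriction on [w] removes only zero terms. *)
Lemma order_sum_content (g : labelling la N) : has_content g ->
  \sum_(w : 'S_N | [forall i, val (g (w i)) == HL_part la i])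
    \prod_(i < N) \prod_(j < N | (i < j)%N) HL_ker t (y g (w i)) (y g (w j)) =
  \prod_(v < (sumn la).+1) q_factorial t (HL_mult la N v).
Proof.
move=> gla; rewrite -(order_sum_labels gla) /order_sum.
rewrite [RHS](bigID (fun w : 'S_N => [forall i, val (g (w i)) == HL_part la i])) /=.
rewrite [X in _ + X]big1 ?addr0 // => w; apply: contraNeq => nz.
by apply/forallP => i; apply/eqP; apply: content_sorted => // {}i j; apply: order_prod_neq0 nz i j.
Qed.

Definition HL_cross (g : labelling la N) : L :=
  \prod_(i < N) \prod_(j < N | j != i) (if (g j < g i)%N then psi i j else 1).

Lemma vdm_HL_cross (g : labelling la N) :
  (\prod_(i < N) \prod_(j < N | (i < j)%N) (x i - x j)) * HL_cross g =
  \prod_(i < N) \prod_(j < N | (i < j)%N) HL_fac t x g i j.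
Proof.
rewrite /HL_cross prod_neq_ltn -big_split; apply: eq_bigr => i _; rewrite -big_split.
apply: eq_bigr => j ij /=; rewrite /HL_fac -val_eqE /=.
have xij : x i - x j != 0 by rewrite subr_eq0 (inj_eq x_inj) neq_ltn ij.
have xji : x j - x i != 0 by rewrite subr_eq0 (inj_eq x_inj) neq_ltn ij orbT.
by case: (ltngtP (g i) (g j)) => _; [field|field|ring].
Qed.

(** Pairs with distinct labels are accounted for by [HL_cross], where the kernel is 1; pairs with
    equal labels by the kernel. *)
Lemma HL_cross_perm (g : labelling la N) (w : 'S_N) :
    (forall i, val (g (w i)) = HL_part la i) ->
  \prod_(i < N) \prod_(j < N | (i < j)%N) psi (w i) (w j) =
  HL_cross g * \prod_(i < N) \prod_(j < N | (i < j)%N) HL_ker t (y g (w i)) (y g (w j)).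
Proof.
move=> gw; rewrite /HL_cross -(prod_neq_perm _ w) prod_neq_ltn -big_split.
apply: eq_bigr => i _; rewrite -big_split; apply: eq_bigr => j ij /=.
rewrite /HL_ker /= !gw; have := HL_part_geq la_sorted (ltnW ij).
by case: ltngtP => // _ _; rewrite ?mulr1 ?mul1r.
Qed.

(** Group the permutations by the exponent vector [gof w] of their monomial. Within a group
    [HL_cross] is constant, and [order_sum_content] sums what remains. *)
Lemma HL_symmetrization :
  (\sum_(w : 'S_N) ((\prod_(i < N) x (w i) ^+ HL_part la i) *
     \prod_(i < N) \prod_(j < N | (i < j)%N) psi (w i) (w j))) *
  (\prod_(i < N) \prod_(j < N | (i < j)%N) (x i - x j)) =
  (\prod_(v < (sumn la).+1) q_factorial t (HL_mult la N v)) * HL_num la t x.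
Proof.
pose gof (w : 'S_N) : labelling la N := [ffun a => inord (HL_part la ((w^-1)%g a))].
have gofE w i : val (gof w (w i)) = HL_part la i.
  by rewrite ffunE permK; apply/inordK/HL_part_le.
have gofP w g : (gof w == g) = [forall i, val (g (w i)) == HL_part la i].
  apply/eqP/forallP => [<- i|gw]; first by rewrite gofE.
  apply/ffunP => a; apply: val_inj; rewrite -[a](permKV w) gofE.
  exact/esym/eqP.
have gof_content w : has_content (gof w).
  rewrite has_contentP //.
  apply: perm_trans (_ : perm_eq [seq val (gof w (w i)) | i <- enum 'I_N] _).
    rewrite (map_comp (val \o gof w) w) perm_sym.
    exact/perm_map/perm_map_enum.
  by rewrite (eq_map (gofE w)).
rewrite (partition_big gof (@has_content la N)) //= big_distrl big_distrr /=.
apply: eq_bigr => g gla; rewrite -vdm_HL_cross -(order_sum_content gla).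
rewrite !big_distrl; apply: eq_big => w; rewrite gofP // => /forallP gw.
have {}gw i : val (g (w i)) = HL_part la i by apply/eqP.
rewrite (HL_cross_perm gw) [X in _ = _ * (X * _)](reindex_inj (@perm_inj _ w)) /=.
under [X in _ = _ * (X * _)]eq_bigr do rewrite gw.
ring.
Qed.

End Symmetrization.

Lemma q_factorial_neq0 (L : fieldType) (t : L) m :
  (forall j, (0 < j)%N -> 1 - t ^+ j != 0) -> q_factorial t m != 0.
Proof.
move=> tj; rewrite /q_factorial prodf_seq_neq0; apply/allP => j.
rewrite mem_index_iota => /andP[j0 _] /=.
by rewrite mulf_neq0 ?invr_eq0 ?tj // -[t]expr1 tj.
Qed.

Lemma tofrac_HL_poly la N : sorted geq la -> 0%N \notin la -> (size la <= N)%N ->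
  tofrac (HL_poly la N) = HL_ratfun la N.
Proof.
move=> la_sorted la0 leN; rewrite /HL_ratfun.
pose t := tofrac ('X%:MP : {mpoly {poly int}[N]}); set S := \sum_(w : 'S_N) _.
pose x i := tofrac ('X_i : {mpoly {poly int}[N]}).
have x_inj : injective x.
  move=> i j /eqP; rewrite /x tofrac_eq => /eqP/(congr1 (mcoeff U_(i)))/eqP.
  by rewrite !mcoeffXU eqxx; case: (j =P i) => [-> //|_]; rewrite oner_eq0.
have x0 i : x i != 0 by rewrite tofrac_eq0 -msupp_eq0 msuppX.
have tj j : (0 < j)%N -> 1 - t ^+ j != 0.
  move=> j0; have -> : 1 - t ^+ j = tofrac ((1 - 'X^j)%:MP : {mpoly {poly int}[N]}).
    by rewrite mpolyCB mpolyC1 rmorphXn /= tofracB tofrac1 tofracXn.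
  by rewrite tofrac_eq0 mpolyC_eq0 -opprB oppr_eq0 monic_neq0 // monicXnsubC.
have t1 : 1 - t != 0 by rewrite -[t]expr1 tj.
have normE : HL_norm la N = \prod_(v < (sumn la).+1) q_factorial t (HL_mult la N v).
  by rewrite /HL_norm big_mkord.
have norm0 : HL_norm la N != 0.
  by rewrite normE; apply/prodf_neq0 => v _; apply: q_factorial_neq0.
have vdm0 : tofrac (vdm {poly int} N) != 0 by rewrite tofrac_eq0 vdm_neq0.
apply: (mulfI norm0); rewrite (mulVKf norm0); apply: (mulIf vdm0).
have vdmE : tofrac (vdm {poly int} N) = \prod_(i < N) \prod_(j < N | (i < j)%N) (x i - x j).
  rewrite rmorph_prod; apply: eq_bigr => i _; rewrite rmorph_prod.
  by apply: eq_bigr => j _; rewrite rmorphB.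
have := HL_symmetrization t1 x_inj x0 la_sorted la0 leN.
rewrite -vdmE => ->; rewrite normE -mulrA; congr (_ * _).
rewrite -tofracM [X in tofrac X]mulrC vdm_HL_poly.
exact: (rmorph_HL_num la (@tofrac _)).
Qed.

(** [HL_sym] satisfies the defining property, and injectivity of [tofrac] gives uniqueness for
    [size la <= N]. *)
Lemma HL_P_sym la n : is_partition n la -> HL_P la = HL_sym la.
Proof.
case/and3P => la_sorted la0 _.
have HP N : (size la <= N)%N -> tofrac (HL_P la N) = HL_ratfun la N.
  move: N; pose P f := forall N, (size la <= N)%N -> tofrac (symfun_val f N) = HL_ratfun la N.
  have exP : exists f, P f by exists (HL_sym la) => N leN; apply: tofrac_HL_poly.
  exact: (classical_sets.xgetPex 0 exP).
apply: val_inj; apply: functional_extensionality_dep => N.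
have /asboolP[_ HD _] := symfunP (HL_P la).
(* With too few variables, add [k] of them and descend by [drop_var]. *)
suff H k : forall M, (size la <= M + k)%N -> HL_P la M = HL_poly la M.
  exact: (H (size la)) (leq_addl _ _).
elim: k => [|k IHk] M; last first.
  by move=> leM; rewrite -[LHS]HD -[RHS]drop_var_HL_poly IHk // addSnnS.
rewrite addn0 => leM; apply/eqP; rewrite -tofrac_eq HP //.
by apply/eqP; rewrite tofrac_HL_poly.
Qed.

(** * Principal specialization *)

(** The value of [HL_phi m] at [t], usually written [(t; t)_m]. *)
Definition q_poch (K : comNzRingType) (t : K) (m : nat) : K := \prod_(1 <= j < m.+1) (1 - t ^+ j).

Lemma q_factorialE (K : fieldType) (t : K) m : 1 - t != 0 ->
  q_factorial t m * (1 - t) ^+ m = q_poch t m.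
Proof.
move=> t1; rewrite /q_factorial /q_poch -{2}(subn0 m) -[(m - 0)%N]/(m.+1 - 1)%N -prodr_const_nat.
by rewrite -big_split; apply: eq_bigr => j _ /=; rewrite divfK.
Qed.

Section PrincipalSpecialization.
Variables (K : fieldType) (tau : K).
Hypotheses (tau0 : tau != 0) (tauX : forall k, (0 < k)%N -> tau ^+ k != 1).

Lemma tau1 : 1 - tau != 0.
Proof. by rewrite subr_eq0 eq_sym -[tau]expr1 tauX. Qed.

Lemma exp_tau_inj : injective (fun i : nat => tau ^+ i).
Proof.
have lt_neq i j : (i < j)%N -> tau ^+ i != tau ^+ j.
  move=> ij; rewrite -(subnKC (ltnW ij)) exprD -{1}[tau ^+ i]mulr1.
  by rewrite (inj_eq (mulfI _)) ?expf_neq0 // eq_sym tauX ?subn_gt0.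
move=> i j /eqP; case: (ltngtP i j) => // /lt_neq; first by move/negbTE->.
by rewrite eq_sym => /negbTE ->.
Qed.

(* An ordering w contributes 0 as soon as w^-1 has a descent at k, because
   of the factor tau ^+ k.+1 - tau * tau ^+ k. *)
Lemma order_sum_principal n (y : 'I_n -> K * nat) :
    (forall i, (y i).1 = tau ^+ i) ->
    (forall i j : 'I_n, (i < j)%N -> ((y j).2 <= (y i).2)%N) ->
  order_sum (HL_ker tau) y =
  \prod_(i < n) \prod_(j < n | (i < j)%N) HL_ker tau (y i) (y j).
Proof.
move=> y1 y2; rewrite /order_sum (bigD1 1%g) //= [X in _ + X]big1 ?addr0 => [|w].
  by apply: eq_bigr => i _; apply: eq_bigr => j _; rewrite !perm1.
apply: contraNeq => nz; apply/eqP.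
have w_geq := order_prod_neq0 nz.
have step (i j : 'I_n) : j = i.+1 :> nat -> ((w^-1)%g i < (w^-1)%g j)%N.
  move=> ji; rewrite ltn_neqAle (inj_eq val_inj) (inj_eq perm_inj) -(inj_eq val_inj) /= ji.
  rewrite ltn_eqF //= leqNgt; apply: contra nz => ltji; apply/eqP.
  rewrite (bigD1 ((w^-1)%g j)) //= (bigD1 ((w^-1)%g i)) //= !permKV.
  rewrite /HL_ker !y1 ji exprS subrr mul0r.
  case: ifP => [_|/negbT ne]; first by rewrite !mul0r.
  (* For distinct labels the indicator vanishes instead, since labels do not increase with the
     index. *)
  by rewrite ltnNge y2 ?ji // !mul0r.
(* By [step] the values of [w^-1] are increasing, which forces the identity. *)
suff vE : [seq val ((w^-1)%g i) | i <- enum 'I_n] = [seq val i | i <- enum 'I_n].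
  apply/eqP; rewrite -eq_invg1; apply/eqP/permP => i; rewrite perm1; apply: val_inj.
  by move/eq_in_map: vE; apply; rewrite mem_enum.
apply: (@sorted_eq _ leq leq_trans anti_leq); last 2 first.
- by rewrite val_enum_ord iota_sorted.
- by rewrite (map_comp val (w^-1)%g); apply/perm_map/perm_map_enum.
apply/(sortedP 0%N) => i; rewrite size_map size_enum_ord => iltn.
have ilt := ltnW iltn; have nthE k : (k < n)%N -> nth 0%N [seq val ((w^-1)%g i) | i <- enum 'I_n] k =
    (w^-1)%g (nth (Ordinal ilt) (enum 'I_n) k).
  by move=> kn; apply: nth_map; rewrite size_enum_ord.
by rewrite (nthE _ ilt) (nthE _ iltn); apply/ltnW/step; rewrite !nth_enum_ord.
Qed.

(** If [g i < g i.+1], the factor [tau * x i - x i.+1] is 0. Only nonincreasing labellings survive,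
    and [g0] is the only one with the right content. *)
Lemma HL_num_principal la N (g0 : labelling la N) :
    sorted geq la -> 0%N \notin la -> (size la <= N)%N ->
    (forall i, val (g0 i) = HL_part la i) -> has_content g0 ->
  let x := fun i : 'I_N => tau ^+ i in
  HL_num la tau x = (\prod_i x i ^+ HL_part la i) *
    ((\prod_(i < N) \prod_(j < N | (i < j)%N) (x i - x j)) * HL_cross tau x g0).
Proof.
move=> la_sorted la0 leN g0E g0la x.
have x_inj : injective x by move=> i j /exp_tau_inj/val_inj.
rewrite vdm_HL_cross // /HL_num (bigD1 g0) //= [X in _ + X]big1 ?addr0 => [|g /andP[gla]].
  by congr (_ * _); apply: eq_bigr => i _; rewrite g0E.
apply: contraNeq; rewrite mulf_eq0 negb_or => /andP[_ nz].
have g_step (i j : 'I_N) : j = i.+1 :> nat -> (g j <= g i)%N.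
  move=> ji; rewrite leqNgt; apply: contra nz => ltg; apply/eqP.
  rewrite (bigD1 i) //= (bigD1 j) ?ji //= /HL_fac -val_eqE /= ltn_eqF // ltnNge ltnW //=.
  by rewrite /x ji exprS subrr !mul0r.
have g_geq (i j : 'I_N) : (i < j)%N -> (g ((1%g : 'S_N) j) <= g ((1%g : 'S_N) i))%N.
  rewrite !perm1; have [k kN] := ubnP (val j).
  elim: k j kN => // k IHk j; rewrite ltnS => jk ij.
  have j0 : (0 < j)%N by apply: leq_ltn_trans ij.
  have j1N : (j.-1 < N)%N by rewrite prednK // ltnW.
  apply: leq_trans (g_step (Ordinal j1N) j _) _; first by rewrite /= prednK.
  have : (i <= j.-1)%N by rewrite -ltnS prednK.
  rewrite leq_eqVlt => /orP[/eqP ij1|ij1]; last by apply: IHk => //=; rewrite prednK.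
  by rewrite (_ : Ordinal j1N = i) //; apply: val_inj.
apply/eqP/ffunP => i; apply: val_inj; rewrite g0E.
by rewrite -(content_sorted la_sorted la0 leN gla g_geq) perm1.
Qed.

(** By [order_sum_principal] both ordering sums reduce to the identity ordering. Constant labels
    give the product over all pairs, labels [la] its part over equal labels, and [HL_cross] is the
    quotient. *)
Lemma HL_cross_principal la N (g0 : labelling la N) :
    sorted geq la -> 0%N \notin la -> (size la <= N)%N ->
    (forall i, val (g0 i) = HL_part la i) -> has_content g0 ->
  let x := fun i : 'I_N => tau ^+ i in
  HL_cross tau x g0 * \prod_(v < (sumn la).+1) q_factorial tau (HL_mult la N v) =
  q_factorial tau N.
Proof.
move=> la_sorted la0 leN g0E g0la x.
have x_inj : injective x by move=> i j /exp_tau_inj/val_inj.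
have x0 i : x i != 0 by rewrite expf_neq0.
have g0w i : val (g0 ((1%g : 'S_N) i)) = HL_part la i by rewrite perm1 g0E.
have := @order_sum_HL _ _ tau1 _ (fun i => (x i, 0%N)) 1 x_inj x0 (fun=> isT).
rewrite big_ord1 [X in q_factorial _ X](_ : _ = N); last first.
  by rewrite -[RHS]card_ord; apply: eq_card => i; rewrite !inE.
move=> <-; rewrite order_sum_principal //.
transitivity (\prod_(i < N) \prod_(j < N | (i < j)%N)
    ((x ((1%g : 'S_N) i) - tau * x ((1%g : 'S_N) j)) / (x ((1%g : 'S_N) i) - x ((1%g : 'S_N) j)))).
  rewrite (HL_cross_perm tau x la_sorted g0w); congr (_ * _).
  rewrite -(order_sum_labels tau1 x_inj x0 la0 leN g0la) order_sum_principal //.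
    by apply: eq_bigr => i _; apply: eq_bigr => j _; rewrite !perm1.
  by move=> i j ij /=; rewrite !g0E; apply: HL_part_geq => //; apply: ltnW.
by apply: eq_bigr => i _; apply: eq_bigr => j _; rewrite !perm1 /HL_ker eqxx.
Qed.

End PrincipalSpecialization.

Lemma dhomog_map_mpoly (R S : nzRingType) (f : {rmorphism R -> S}) N d (p : {mpoly R[N]}) :
  p \is d.-homog -> map_mpoly f p \is d.-homog.
Proof.
move=> /dhomogP hp; apply/dhomogP => m; rewrite mcoeff_msupp mcoeff_map_mpoly => nz.
by apply: hp; rewrite mcoeff_msupp; apply: contraNneq nz => ->; rewrite raddf0.
Qed.

Lemma q_pochD (K : comNzRingType) (t : K) l m : (l <= m)%N ->
  q_poch t m = q_poch t (m - l) * \prod_(i < l) (1 - t ^+ (m - i)).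
Proof.
elim: l => [|l IHl] lm; first by rewrite subn0 big_ord0 mulr1.
rewrite (IHl (ltnW lm)) big_ord_recr /= mulrA mulrAC; congr (_ * _).
by rewrite -(subnSK lm) [LHS]big_nat_recr.
Qed.

Section Specialization.
Variables (K : comNzRingType) (tau : K) (la : seq nat) (n : nat).
Hypothesis la_part : is_partition n la.

Definition HL_scal : K := \prod_(1 <= i < (sumn la).+1) q_poch tau (count_mem i la).

Local Notation phi := (horner_eval tau \o map_poly intr : {poly int} -> K).

Lemma specX : phi 'X = tau.
Proof. by rewrite /= map_polyX /horner_eval hornerX. Qed.

Lemma HL_Q_atE N : HL_Q_at la tau N = HL_scal *: map_mpoly phi (HL_poly la N).
Proof.
rewrite -[LHS]/(map_mpoly phi ((HL_Q la : mpolys _) N)) /HL_Q (HL_P_sym la_part).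
rewrite -[X in map_mpoly _ X]/(_ *: HL_poly la N) map_mpolyZ; congr (_ *: _).
rewrite rmorph_prod; apply: eq_bigr => i _; rewrite rmorph_prod; apply: eq_bigr => j _.
by rewrite /= rmorphB rmorph1 /= map_polyXn /horner_eval !hornerE.
Qed.

Lemma HL_Q_at_homog N : HL_Q_at la tau N \is n.-homog.
Proof.
case/and3P: la_part => _ _ /eqP <-.
by rewrite HL_Q_atE; apply/rpredZ/dhomog_map_mpoly/HL_poly_homog.
Qed.

Lemma HL_Q_at_sym N : HL_Q_at la tau N \is symmetric.
Proof. by have /asboolP[] := symfunP (HL_Q_at la tau). Qed.

End Specialization.

(** Clearing powers of [1 - tau] in [HL_cross_principal] turns the surviving term into a power of
    [tau] times [q_poch tau N / q_poch tau (N - size la)]. *)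
Lemma HL_Q_at_principal (K : fieldType) (tau : K) la n N :
    tau != 0 -> (forall k, (0 < k)%N -> tau ^+ k != 1) ->
    is_partition n la -> (size la <= N)%N ->
  (HL_Q_at la tau N).@[fun i => tau ^+ i] =
  (\prod_(i < size la) (tau ^+ i) ^+ nth 0%N la i) * \prod_(i < size la) (1 - tau ^+ (N - i)).
Proof.
move=> tau0 tauX la_part leN; case/and3P: (la_part) => la_sorted la0 _.
pose x (i : 'I_N) := tau ^+ i.
have x_inj : injective x by move=> i j /(exp_tau_inj tau0 tauX)/val_inj.
pose g0 : labelling la N := [ffun i => inord (HL_part la i)].
have g0E i : val (g0 i) = HL_part la i by rewrite ffunE; apply/inordK/HL_part_le.
have g0la : has_content g0 by rewrite has_contentP // (eq_map g0E).
have tau1 := tau1 tauX.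
pose P := map_mpoly (horner_eval tau \o map_poly intr) (HL_poly la N).
have valP : P.@[x] = (\prod_i x i ^+ HL_part la i) * HL_cross tau x g0.
  have V0 : \prod_(i < N) \prod_(j < N | (i < j)%N) (x i - x j) != 0.
    apply/prodf_neq0 => i _; apply/prodf_neq0 => j ij.
    by rewrite subr_eq0 (inj_eq x_inj) neq_ltn ij.
  apply: (mulfI V0); rewrite mulrCA -(HL_num_principal tau0 tauX) //.
  have <- : (map_mpoly (horner_eval tau \o map_poly intr) (vdm {poly int} N)).@[x]
      = \prod_(i < N) \prod_(j < N | (i < j)%N) (x i - x j).
    rewrite !rmorph_prod; apply: eq_bigr => i _; rewrite !rmorph_prod; apply: eq_bigr => j _.
    by rewrite !rmorphB /= !map_mpolyX !mevalXU.
  rewrite -mevalM -rmorphM vdm_HL_poly rmorph_HL_num rmorph_HL_num.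
  have tauE : (map_mpoly (horner_eval tau \o map_poly intr) ('X%:MP : {mpoly {poly int}[N]})).@[x] = tau.
    by rewrite map_mpolyC mevalC; apply: specX.
  rewrite -[X in _ = HL_num la X _]tauE.
  by apply: eq_HL_num => i; rewrite /= map_mpolyX mevalXU.
have poch0 m : q_poch tau m != 0.
  rewrite /q_poch prodf_seq_neq0; apply/allP => j; rewrite mem_index_iota => /andP[j0 _] /=.
  by rewrite subr_eq0 eq_sym tauX.
(* This is the factor of the zero labels, which [HL_scal] omits. *)
apply: (mulIf (poch0 (N - size la)%N)).
rewrite -[RHS]mulrA [X in _ = _ * X]mulrC -q_pochD // (HL_Q_atE tau la_part) mevalZ -/P valP.
have -> : \prod_(i < N) x i ^+ HL_part la i = \prod_(i < size la) (tau ^+ i) ^+ nth 0%N la i.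
  rewrite (big_ord_widen N (fun i => (tau ^+ i) ^+ nth 0%N la i) leN) [RHS]big_mkcond.
  by apply: eq_bigr => i _; case: ltnP => // ?; rewrite /HL_part nth_default.
have -> : q_poch tau N = HL_cross tau x g0 * \prod_(v < (sumn la).+1) q_poch tau (HL_mult la N v).
  rewrite -q_factorialE // -(HL_cross_principal tau0 tauX la_sorted la0 leN g0E g0la) -mulrA.
  congr (_ * _); rewrite -[X in _ ^+ X](sum_HL_mult la N) expr_sum -big_split.
  by apply: eq_bigr => v _; rewrite -q_factorialE.
have -> : \prod_(v < (sumn la).+1) q_poch tau (HL_mult la N v) =
    q_poch tau (N - size la) * HL_scal tau la.
  rewrite big_ord_recl HL_multE // (count_memPn la0) add0n; congr (_ * _).
  by rewrite /HL_scal big_add1 big_mkord; apply: eq_bigr => i _; rewrite HL_multE.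
ring.
Qed.

(** * Stable symmetric polynomials *)

Section Mmap.
Variables (R : nzRingType) (N : nat).

Lemma eq_mmap (S : nzRingType) (f f' : R -> S) (h h' : 'I_N -> S) (p : {mpoly R[N]}) :
  f =1 f' -> h =1 h' -> mmap f h p = mmap f' h' p.
Proof.
move=> ff hh; apply: eq_bigr => m _; rewrite ff; congr (_ * _).
by apply: eq_bigr => i _; rewrite hh.
Qed.

Lemma rmorph_mmap (S S' : nzRingType) (g : {rmorphism S -> S'}) (f : R -> S) (h : 'I_N -> S)
    (p : {mpoly R[N]}) : g (mmap f h p) = mmap (g \o f) (g \o h) p.
Proof.
rewrite rmorph_sum; apply: eq_bigr => m _; rewrite rmorphM rmorph_prod; congr (_ * _).
by apply: eq_bigr => i _; rewrite rmorphXn.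
Qed.

End Mmap.

Lemma mmap_comp (R S : comNzRingType) (f : {rmorphism R -> S}) n N (h : 'I_N -> S)
    (lq : n.-tuple {mpoly R[N]}) (p : {mpoly R[n]}) :
  mmap f h (p \mPo lq) = mmap f (fun i => mmap f h (tnth lq i)) p.
Proof. by rewrite (rmorph_mmap (mmap f h)); apply: eq_mmap => // c; apply: mmapC. Qed.

Lemma comp_mpolyA (R : comNzRingType) n N M (p : {mpoly R[n]}) (lq : n.-tuple {mpoly R[N]})
    (lr : N.-tuple {mpoly R[M]}) :
  (p \mPo lq) \mPo lr = p \mPo [tuple tnth lq i \mPo lr | i < n].
Proof.
rewrite [LHS]mmap_comp; apply: eq_mmap => // i.
by rewrite tnth_mktuple.
Qed.

Lemma eq_comp_mpoly (R : comNzRingType) n N (p : {mpoly R[n]}) (lq lr : n.-tuple {mpoly R[N]}) :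
  (forall m, m \in msupp p -> forall i, m i != 0%N -> tnth lq i = tnth lr i) ->
  p \mPo lq = p \mPo lr.
Proof.
move=> lqr; apply: eq_big_seq => m mp; congr (_ * _); apply: eq_bigr => i _.
by have [->|mi] := eqVneq (m i) 0%N; rewrite ?expr0 // (lqr m mp).
Qed.

Section DropVar.
Variables (R : comNzRingType) (N : nat).

Lemma drop_varX (i : 'I_N.+1) :
  drop_var ('X_i : {mpoly R[N.+1]}) = if unlift ord_max i is Some j then 'X_j else 0.
Proof. by rewrite /drop_var comp_mpolyXU -tnth_nth tnth_mktuple. Qed.

Lemma drop_var_mwiden (p : {mpoly R[N]}) : drop_var (mwiden p) = p.
Proof.
rewrite /drop_var (rmorph_mmap (comp_mpoly _)) -[RHS]comp_mpoly_id.
apply: eq_mmap => [c|i]; first exact: comp_mpolyC.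
have widenE : widen_ord (leqnSn N) i = lift ord_max i by apply/val_inj/esym/lift_max.
rewrite tnth_mktuple; transitivity (drop_var ('X_(widen_ord (leqnSn N) i) : {mpoly R[N.+1]})) => //.
by rewrite widenE drop_varX liftK.
Qed.

Lemma drop_var_mesym k : drop_var (mesym N.+1 R k) = mesym N R k.
Proof.
case: k => [|k]; first by rewrite !mesym0E /drop_var rmorph1.
rewrite mesymSS -[RHS]addr0.
rewrite /drop_var raddfD /= rmorphM /= -!/(drop_var _) !drop_var_mwiden drop_varX.
by rewrite unlift_none mulr0.
Qed.

Definition mnm_lift (m : 'X_{1..N}) : 'X_{1..N.+1} :=
  [multinom if unlift ord_max i is Some j then m j else 0%N | i < N.+1].

Lemma mcoeff_drop_var (p : {mpoly R[N.+1]}) (m : 'X_{1..N}) :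
  (drop_var p)@_m = p@_(mnm_lift m).
Proof.
have XP (m' : 'X_{1..N.+1}) : (drop_var 'X_[R, m'])@_m = (m' == mnm_lift m)%:R.
  rewrite /drop_var comp_mpolyX prod_ord_lift tnth_mktuple unlift_none.
  have -> : \prod_(i < N) tnth [tuple if unlift ord_max k is Some j then 'X_j else 0 | k < N.+1]
      (lift ord_max i) ^+ m' (lift ord_max i) = 'X_[R, [multinom m' (lift ord_max i) | i < N]].
    rewrite mpolyXE_id; apply: eq_bigr => i _.
    by rewrite tnth_mktuple liftK mnmE.
  rewrite expr0n mulr_natr mcoeffMn mcoeffX -[LHS]mulr_natr -natrM mulnb; congr (nat_of_bool _)%:R.
  apply/andP/eqP => [[/eqP <- /eqP max0]|->]; last first.
    split; last by rewrite mnmE unlift_none.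
    by apply/eqP/mnmP => i; rewrite !mnmE liftK.
  apply/mnmP => i; rewrite mnmE; case: unliftP => [j|] -> //.
  by rewrite mnmE.
elim/mpolyind: p => [|c m' p _ _ IHp].
  by rewrite /drop_var raddf0 !mcoeff0.
rewrite /drop_var raddfD /= comp_mpolyZ -!/(drop_var _).
by rewrite !mcoeffD !mcoeffZ IHp XP mcoeffX.
Qed.

(** A monomial of degree at most [N] misses one of the [N.+1] variables; by symmetry that variable
    may be taken to be the last, where [drop_var] preserves the coefficient. *)
Lemma drop_var_inj (p : {mpoly R[N.+1]}) :
  p \is symmetric -> (msize p <= N.+1)%N -> drop_var p = 0 -> p = 0.
Proof.
move=> p_sym szp drop0; apply/mpolyP => m; rewrite mcoeff0.
apply/eqP; apply: contraT; rewrite -mcoeff_msupp => mp.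
have [i /eqP mi] : exists i, m i == 0%N.
  apply/existsP; apply: contraT; rewrite negb_exists => /forallP m_gt0.
  have := leq_trans (msize_mdeg_lt mp) szp; rewrite ltnS leqNgt => /negP[].
  rewrite mdegE -[X in (X <= _)%N]card_ord -sum1_card; apply: leq_sum => i _.
  by rewrite lt0n.
have : (drop_var p)@_[multinom m (tperm i ord_max (lift ord_max j)) | j < N] = 0.
  by rewrite drop0 mcoeff0.
rewrite mcoeff_drop_var => /eqP; rewrite mcoeff_eq0.
have -> : mnm_lift [multinom m (tperm i ord_max (lift ord_max j)) | j < N] =
    [multinom m (tperm i ord_max j) | j < N.+1].
  apply/mnmP => j; rewrite !mnmE; case: unliftP => [k|] ->; first by rewrite mnmE.
  by rewrite tpermR mi.
by rewrite issym_msupp // mp.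
Qed.

End DropVar.

Lemma msize_mulr (R : idomainType) N (p q : {mpoly R[N]}) a b :
  (msize p <= a.+1)%N -> (msize q <= b.+1)%N -> (msize (p * q) <= (a + b).+1)%N.
Proof.
move=> pa qb; have [->|p0] := eqVneq p 0; first by rewrite mul0r msize0.
have [->|q0] := eqVneq q 0; first by rewrite mulr0 msize0.
rewrite msizeM // -ltnS -addSn -addnS; apply: leq_trans (leq_add pa qb).
by rewrite prednK // addn_gt0 lt0n msize_poly_eq0 p0.
Qed.

(** Since [msize] is the degree plus one, the hypothesis bounds the degree of [y i] by the weight
    [i.+1] of the variable [i]. *)
Lemma msize_prod_exp (R : idomainType) N n (y : 'I_n -> {mpoly R[N]}) (m : 'X_{1..n}) :
    (forall i, m i != 0%N -> (msize (y i) <= i.+2)%N) ->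
  (msize (\prod_i y i ^+ m i) <= (mnmwgt m).+1)%N.
Proof.
move=> yi; apply: (big_rec2 (fun p d => (msize p <= d.+1)%N)) => [|i d p _ pd].
  by rewrite msize1.
apply: msize_mulr => //; have [->|mi] := eqVneq (m i) 0%N.
  by rewrite expr0 mul0n msize1.
elim: (m i) => [|k IHk]; first by rewrite expr0 mul0n msize1.
by rewrite exprS mulSn; apply: msize_mulr => //; apply: yi.
Qed.

Lemma msize_comp_mpoly (R : idomainType) N n d (q : {mpoly R[n]}) (y : n.-tuple {mpoly R[N]}) :
    (forall m, m \in msupp q -> (mnmwgt m <= d)%N) ->
    (forall m, m \in msupp q -> forall i, m i != 0%N -> (msize (tnth y i) <= i.+2)%N) ->
  (msize (q \mPo y) <= d.+1)%N.
Proof.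
move=> qd yi; rewrite comp_mpolyEX big_seq.
apply: (big_ind (fun p => msize p <= d.+1)%N) => [|p p' pd pd'|m mq].
- by rewrite msize0.
- by apply: leq_trans (msizeD_le _ _) _; rewrite geq_max pd.
apply: leq_trans (msizeZ_le _ _) _; rewrite comp_mpolyX.
by apply: leq_trans (msize_prod_exp (yi m mq)) _; rewrite ltnS qd.
Qed.

(** The variable [j] alone has weight [j.+1], which already exhausts the total weight. This is the
    source of triangularity. *)
Lemma mnmwgt_eqU n (m : 'X_{1..n}) (i j : 'I_n) :
  mnmwgt m = i.+1 -> (i <= j)%N -> m j != 0%N -> m = U_(i)%MM.
Proof.
move=> mi ij mj; have Um : (U_(j) <= m)%MM.
  by apply/mnm_lepP => k; rewrite mnm1E; case: eqP => // <-; rewrite lt0n.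
have := mi; rewrite -(submK Um) mnmwgtD mnmwgt1 => e.
have ji : (j <= i)%N by rewrite -ltnS -e leq_addl.
have jE : j = i by apply: val_inj; apply/eqP; rewrite eqn_leq ji.
rewrite jE in e *; move/eqP: e; rewrite -[X in _ == X]add0n eqn_add2r => /eqP e.
have /eqP -> : (m - U_(i))%MM == 0%MM.
  by rewrite -mdeg_eq0 -leqn0 -e leq_mdeg_mnmwgt.
by rewrite add0m.
Qed.

(** * Generators *)

Section ElementaryPrincipal.
Variables (K : fieldType) (tau : K).
Hypotheses (tau0 : tau != 0) (tauX : forall k, (0 < k)%N -> tau ^+ k != 1).

Lemma meval_mwiden N (v : 'I_N.+1 -> K) (p : {mpoly K[N]}) :
  (mwiden p).@[v] = p.@[fun i => v (lift ord_max i)].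
Proof.
rewrite (rmorph_mmap (meval v)); apply: eq_mmap => [c|i]; first exact: mevalC.
rewrite /= mevalXU; congr v; exact/val_inj/esym/lift_max.
Qed.

(* With u = tau ^+ N, the recursion e_k(N+1) = e_k(N) + tau ^+ N * e_(k-1)(N)
   becomes E_k(tau * u) - E_k(u) = u * E_(k-1)(u), which is solved coefficientwise. *)
Lemma mesym_principal k : exists E : {poly K}, forall N,
  (mesym N K k).@[fun i => tau ^+ i] = E.[tau ^+ N].
Proof.
elim: k => [|k [E IHE]]; first by exists 1 => N; rewrite mesym0E meval1 hornerC.
pose A := \poly_(i < (size E).+1) (if i is j.+1 then E`_j / (tau ^+ j.+1 - 1) else 0).
have AE u : A.[tau * u] - A.[u] = u * E.[u].
  rewrite !horner_poly !big_ord_recl /= !mul0r !add0r -sumrB horner_coef big_distrr /=.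
  apply: eq_bigr => i _; rewrite /bump /= add1n.
  have nz : tau ^+ i.+1 - 1 != 0 by rewrite subr_eq0 tauX.
  by rewrite exprMn -mulrBr -{2}[u ^+ i.+1]mul1r -mulrBl mulrA divfK // exprS mulrCA.
(* Subtracting [A.[1]] gives the value 0 at [N = 0], that is at [u = 1]. *)
exists (A - (A.[1])%:P) => N; rewrite hornerD hornerN hornerC.
elim: N => [|N IHN]; first by rewrite mesym_geqnE // meval0 expr0 subrr.
rewrite mesymSS mevalD mevalM meval_mwiden.
rewrite (meval_eq _ (_ : _ =1 fun i : 'I_N => tau ^+ i)); last by move=> i; rewrite lift_max.
rewrite IHN meval_mwiden (meval_eq _ (_ : _ =1 fun i : 'I_N => tau ^+ i)); last first.
  by move=> i; rewrite lift_max.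
rewrite IHE mevalXU mulrC -AE exprS; ring.
Qed.

Lemma poly_eq_geometric (p q : {poly K}) N0 :
  (forall N, (N0 <= N)%N -> p.[tau ^+ N] = q.[tau ^+ N]) -> p = q.
Proof.
move=> pq; apply/eqP; rewrite -subr_eq0; apply/eqP.
apply: (@roots_geq_poly_eq0 _ _ [seq tau ^+ N | N <- iota N0 (size (p - q))]).
- apply/allP => _ /mapP[N + ->]; rewrite mem_iota => /andP[N0N _].
  by rewrite rootE hornerD hornerN subr_eq0 pq.
- by rewrite (map_inj_uniq (exp_tau_inj tau0 tauX)) iota_uniq.
by rewrite size_map size_iota.
Qed.

End ElementaryPrincipal.

(** * The coefficient of the top elementary polynomial *)

Section Coefficient.
Variables (K : fieldType) (tau : K) (la : nat -> seq nat).
Hypotheses (tau0 : tau != 0) (tauX : forall k, (0 < k)%N -> tau ^+ k != 1).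
Hypothesis la_part : forall n, is_partition n (la n).

Local Notation u n := (HL_Q_at (la n) tau).
Local Notation S n N := [tuple mesym N K i.+1 | i < n].

(** Both sides have degree at most [i.+1 <= n], so [drop_var_inj] lifts the equality from [M]
    variables to [M.+1]. *)
Lemma mesym_expr_stable n (i : 'I_n) (T : {mpoly K[n]}) :
    T \is (i.+1).-homog for mnmwgt -> T \mPo S n n = u i.+1 n ->
  forall N, (n <= N)%N -> T \mPo S n N = u i.+1 N.
Proof.
move=> /dhomogP Thom Tn N /subnKC <-; elim: (N - n)%N => [|k IHk]; first by rewrite addn0.
rewrite addnS; set M := (n + k)%N in IHk *.
apply/eqP; rewrite -subr_eq0; apply/eqP; apply: drop_var_inj.
- apply: rpredB; last exact: HL_Q_at_sym.
  by apply: mcomp_sym => j; rewrite -tnth_nth tnth_mktuple mesym_sym.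
- have leM : (i.+2 <= M.+1)%N by rewrite ltnS ltn_addr.
  apply: leq_trans (msizeD_le _ _) _; rewrite geq_max msizeN.
  rewrite (leq_trans (msize_dhomog (HL_Q_at_homog tau (la_part i.+1) _))) // andbT.
  apply: leq_trans leM; apply: msize_comp_mpoly => [m /Thom -> //|m _ j _].
  by rewrite tnth_mktuple; apply/msize_dhomog/dhomog_mesym.
rewrite /drop_var raddfB /= -!/(drop_var _).
have /asboolP[_ -> _] := symfunP (u i.+1).
rewrite -IHk /drop_var comp_mpolyA; apply/eqP; rewrite subr_eq0; apply/eqP.
congr (_ \mPo _); apply: eq_from_tnth => j; rewrite !tnth_mktuple.
exact: drop_var_mesym.
Qed.

Lemma size_partition n s : is_partition n s -> (size s <= n)%N.
Proof.
case/and3P => _ s0 /eqP <-; elim: s s0 => //= v s IHs; rewrite inE negb_or => /andP[v0 /IHs].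
by move=> les; rewrite -add1n leq_add // lt0n eq_sym.
Qed.

Lemma size_partition_gt0 n s : is_partition n.+1 s -> (0 < size s)%N.
Proof. by case: s => // /and3P[]. Qed.

(* If the coefficient vanished, T would only involve monomials of degree at
   least 2 in the e_k, each of which vanishes at u = 1 (that is, at N = 0), so
   the value of [u i.+1] as a polynomial in u = tau ^+ N would have a double
   root at 1; but that root is simple by [HL_Q_at_principal]. *)
Lemma mesym_coef_neq0 n (i : 'I_n) (T : {mpoly K[n]}) :
  T \is (i.+1).-homog for mnmwgt -> T \mPo S n n = u i.+1 n -> T@_U_(i) != 0.
Proof.
move=> Thom Tn; apply/eqP => Ti0.
have [E EP] := choice (mesym_principal tauX).
have E1 k : root (E k.+1) 1.
  by rewrite rootE -[1](expr0 tau) -EP mesym_geqnE // meval0.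
have /choice[F FP] k : exists Fk, E k.+1 = Fk * ('X - 1%:P) by apply/factor_theorem.
pose th := mmap (@polyC K) (fun j : 'I_n => E j.+1) T.
have thP N : (n <= N)%N -> th.[tau ^+ N] = (u i.+1 N).@[fun j => tau ^+ j].
  move=> nN; rewrite -(mesym_expr_stable Thom Tn nN) comp_mpoly_meval /th.
  apply: etrans (rmorph_mmap (horner_eval (tau ^+ N)) _ _ _) _; apply: eq_mmap => [c|j].
    by rewrite /= /horner_eval hornerC.
  by rewrite tnth_mktuple EP.
have th2 : exists G, th = ('X - 1%:P) ^+ 2 * G.
  rewrite /th /mmap big_seq; apply: (big_ind (fun p => exists G, p = ('X - 1%:P) ^+ 2 * G)).
  - by exists 0; rewrite mulr0.
  - by move=> p q [G1 ->] [G2 ->]; exists (G1 + G2); rewrite mulrDr.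
  (* Degree 0 has weight 0, and the only monomial of degree 1 and weight [i.+1] is ['X_i], absent by
     [Ti0]. *)
  move=> m mT; have m2 : (2 <= mdeg m)%N.
    have := dhomogP _ _ _ Thom m mT; case: (ltnP 1 (mdeg m)) => //.
    rewrite leq_eqVlt => /orP[|]; last first.
      by rewrite ltnS leqn0 mdeg_eq0 => /eqP ->; rewrite /= mnmwgt0.
    rewrite mdeg_eq1 => /existsP[j /eqP mE]; rewrite mE /= mnmwgt1 => -[ji].
    by move: mT; rewrite mE (_ : j = i) ?mcoeff_msupp ?Ti0 ?eqxx //; apply: val_inj.
  have -> : mmap1 (fun j : 'I_n => E j.+1) m =
      mmap1 (fun j : 'I_n => F j) m * ('X - 1%:P) ^+ mdeg m.
    rewrite mdegE /mmap1 -prodrXr -big_split; apply: eq_bigr => j _ /=.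
    by rewrite FP exprMn.
  rewrite -(subnKC m2) exprD.
  by exists ((T@_m)%:P * (mmap1 (fun j : 'I_n => F j) m * ('X - 1%:P) ^+ (mdeg m - 2))); ring.
pose cst : K := \prod_(j < size (la i.+1)) (tau ^+ j) ^+ nth 0%N (la i.+1) j.
have cst0 : cst != 0 by apply/prodf_neq0 => j _; rewrite !expf_neq0.
(* [1 - tau ^+ (N - j)] is [1 - tau ^- j * u] at [u = tau ^+ N]; agreement at infinitely many [u]
   identifies the polynomials. *)
have thE : th = cst *: \prod_(j < size (la i.+1)) (1 - (tau ^- j) *: 'X).
  apply: (poly_eq_geometric tau0 tauX (N0 := n)) => N nN.
  have szN : (size (la i.+1) <= N)%N.
    by apply: leq_trans (size_partition (la_part i.+1)) _; apply: leq_trans nN.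
  rewrite thP // (HL_Q_at_principal tau0 tauX (la_part i.+1) szN) hornerZ; congr (_ * _).
  rewrite horner_prod; apply: eq_bigr => j _; rewrite hornerD hornerN hornerZ hornerX hornerC.
  have jN : (j <= N)%N by apply: leq_trans (ltnW (ltn_ord j)) szN.
  by rewrite -[in RHS](subnKC jN) exprD mulKf // expf_neq0.
have [G thG] := th2.
case: (size (la i.+1)) (size_partition_gt0 (la_part i.+1)) thE => // l _ thE.
have X10 : ('X - 1%:P : {poly K}) != 0 by rewrite polyXsubC_eq0.
(* The factor [j = 0] is one root at 1. After cancelling it the left side still vanishes at 1,
   whereas the other factors become [1 - tau ^- j.+1], which is nonzero. *)
have : ('X - 1%:P) * G = - cst *: \prod_(j < l) (1 - (tau ^- j.+1) *: 'X).
  apply: (mulfI X10); rewrite mulrA -expr2 -thG thE big_ord_recl expr0 invr1 scale1r.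
  by rewrite -opprB -polyC1 mulNr scalerN scaleNr scalerAr mulrN.
move/(congr1 (horner^~ 1)); rewrite hornerM hornerXsubC subrr mul0r hornerZ horner_prod.
move/eqP; rewrite eq_sym mulf_eq0 oppr_eq0 (negbTE cst0) /=; apply/negP/prodf_neq0 => j _.
rewrite hornerD hornerN hornerZ hornerX hornerC mulr1 subr_eq0 eq_sym invr_eq1.
by rewrite tauX.
Qed.

End Coefficient.

Section SymfunEvaluation.
Variable K : comNzRingType.

Lemma symfun_mmap n (h : 'I_n -> symfun K) (p : {mpoly K[n]}) N :
  mmap (GRing.in_alg (symfun K)) h p N = p \mPo [tuple h i N | i < n].
Proof.
have projD (f g : symfun K) : (f + g) N = f N + g N by [].
have projM (f g : symfun K) : (f * g) N = f N * g N by [].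
have projX (f : symfun K) e : (f ^+ e) N = f N ^+ e.
  by elim: e => // e IHe; rewrite !exprS projM IHe.
rewrite /comp_mpoly /mmap.
rewrite (big_morph (fun f : symfun K => f N) projD (erefl : (0 : symfun K) N = 0)).
apply: eq_bigr => m _; rewrite projM; congr (_ * _); first exact: alg_mpolyC.
rewrite /mmap1 (big_morph (fun f : symfun K => f N) projM (erefl : (1 : symfun K) N = 1)).
by apply: eq_bigr => i _; rewrite projX tnth_mktuple.
Qed.

End SymfunEvaluation.

Section Generators.
Variables (K : fieldType) (tau : K) (la : nat -> seq nat).
Hypotheses (tau0 : tau != 0) (tauX : forall k, (0 < k)%N -> tau ^+ k != 1).
Hypothesis la_part : forall n, is_partition n (la n).

Local Notation u n := (HL_Q_at (la n) tau).
Local Notation S n N := [tuple mesym N K i.+1 | i < n].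
Local Notation U n N := [tuple u i.+1 N | i < n].

(** [T i] is [c i *: 'X_i] plus terms in earlier variables, so [T] has a compositional inverse [G].
    The degree bound, uniform in [N], prepares for [drop_var_inj]. *)
Lemma HL_Q_triangular n : exists T G : n.-tuple {mpoly K[n]},
  [/\ forall i, tnth T i \mPo S n n = u i.+1 n,
      forall i, tnth T i \mPo G = 'X_i,
      forall i, tnth G i \mPo T = 'X_i
    & forall N i, (msize (tnth G i \mPo U n N) <= i.+2)%N].
Proof.
have /choice[T /all_and2[TS Thom]] (i : 'I_n) : exists Ti : {mpoly K[n]},
    Ti \mPo S n n = u i.+1 n /\ Ti \is (i.+1).-homog for mnmwgt.
  have [Ti Tiu] := sym_fundamental_homog (HL_Q_at_sym tau (la i.+1) n)
    (HL_Q_at_homog tau (la_part i.+1) n).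
  by exists Ti.
pose c i := (T i)@_U_(i).
have c0 i : c i != 0 by apply: (mesym_coef_neq0 tau0 tauX la_part (Thom i) (TS i)).
pose D i := T i - c i *: 'X_i.
have suppD i m : m \in msupp (D i) -> mnmwgt m = i.+1 /\ forall j : 'I_n, m j != 0%N -> (j < i)%N.
  move=> mD; have mU : m != U_(i)%MM.
    by apply: contraTneq mD => ->; rewrite mcoeff_msupp mcoeffB mcoeffZ mcoeffX eqxx mulr1 subrr eqxx.
  have mT : m \in msupp (T i).
    by move: mD; rewrite !mcoeff_msupp mcoeffB mcoeffZ mcoeffX [(_ == m)]eq_sym (negbTE mU) mulr0 subr0.
  have mi : mnmwgt m = i.+1 := dhomogP _ _ _ (Thom i) m mT.
  split=> // j mj; rewrite ltnNge; apply: contra mU => ij.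
  by apply/eqP; apply: mnmwgt_eqU mi ij mj.
pose step (G : n.-tuple {mpoly K[n]}) : n.-tuple {mpoly K[n]} :=
  [tuple (c i)^-1 *: ('X_i - (D i \mPo G)) | i < n].
have D_local N (i : 'I_n) (G G' : n.-tuple {mpoly K[N]}) :
    (forall j : 'I_n, (j < i)%N -> tnth G j = tnth G' j) -> D i \mPo G = D i \mPo G'.
  move=> GG'; apply: eq_comp_mpoly => m /suppD[_ mi] j /mi; exact: GG'.
(* The entry [i] of [step] depends only on earlier entries, so it is stable after [i.+1] rounds and
   [n] rounds reach a fixed point. *)
pose Gk k := iter k step [tuple 0 | i < n].
have GkS k i : tnth (Gk k.+1) i = (c i)^-1 *: ('X_i - (D i \mPo Gk k)).
  exact: tnth_mktuple.
have stable k : forall i : 'I_n, (i < k)%N -> tnth (Gk k.+1) i = tnth (Gk k) i.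
  elim: k => [|k IHk] i; first by rewrite ltn0.
  move=> ik; apply: etrans (GkS _ _) (etrans _ (esym (GkS _ _))).
  congr (_ *: (_ - _)); apply: D_local => j ji; apply: IHk.
  exact: leq_trans ji ik.
pose G := Gk n.
have GE i : tnth G i = (c i)^-1 *: ('X_i - (D i \mPo G)).
  by rewrite -[LHS](stable n i (ltn_ord i)) GkS.
have TE i : T i = D i + c i *: 'X_i by rewrite subrK.
exists [tuple T i | i < n], G; split=> [i|i|i|N i].
- by rewrite tnth_mktuple.
- rewrite tnth_mktuple TE raddfD /= comp_mpolyZ comp_mpolyXU -tnth_nth GE scalerA divff //.
  by rewrite scale1r addrC subrK.
- have [k ik] := ubnP i; elim: k i ik => // k IHk i; rewrite ltnS => ik.
  rewrite GE comp_mpolyZ raddfB /= comp_mpolyXU -tnth_nth tnth_mktuple comp_mpolyA.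
  rewrite (@D_local n i _ [tuple 'X_j | j < n]) => [|j ji]; last first.
    by rewrite !tnth_mktuple IHk // (leq_trans ji).
  by rewrite comp_mpoly_id TE addrC addKr scalerA mulVf // scale1r.
have [k ik] := ubnP i; elim: k i ik => // k IHk i; rewrite ltnS => ik.
rewrite GE comp_mpolyZ raddfB /= comp_mpolyXU -tnth_nth tnth_mktuple comp_mpolyA.
apply: leq_trans (msizeZ_le _ _) _; apply: leq_trans (msizeD_le _ _) _.
rewrite geq_max msizeN msize_dhomog /=; last exact: HL_Q_at_homog.
apply: msize_comp_mpoly => [m /suppD[-> _] //|m /suppD[_ mi] j /mi ji].
by rewrite tnth_mktuple IHk // (leq_trans ji).
Qed.

(** For the empty partition the only labelling is 0, and the numerator is the Vandermonde product
    itself. *)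
Lemma HL_Q_at0 : u 0 = 1.
Proof.
apply: val_inj; apply: functional_extensionality_dep => N.
rewrite [LHS](HL_Q_atE tau (la_part 0)).
have -> : la 0 = [::].
  by case: (la 0) (la_part 0) => // v s /and3P[_]; rewrite inE negb_or /= addn_eq0; case: v.
have -> : HL_poly [::] N = 1.
  apply: (mulfI (vdm_neq0 _ N)); rewrite vdm_HL_poly mulr1 /HL_num.
  have all0 (g : labelling [::] N) i : g i = ord0 by apply: ord1.
  have g0 (g : labelling [::] N) : g = [ffun=> ord0] by apply/ffunP => i; rewrite ffunE all0.
  rewrite (big_pred1 [ffun=> ord0]) => [|g].
    rewrite big1 ?mul1r => [|i _]; last by rewrite ffunE expr0.
    by apply: eq_bigr => i _; apply: eq_bigr => j _; rewrite /HL_fac !ffunE eqxx.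
  rewrite /= [g]g0 eqxx /has_content (eq_map (_ : _ =1 fun=> 0%N)) => [|i]; last by rewrite ffunE.
  by elim: (enum 'I_N).
by rewrite /HL_scal big_geq // scale1r rmorph1.
Qed.

(** A relation [p] among the [u] makes [p \mPo T] a relation among elementary polynomials, hence 0,
    and composing with [G] gives [p = 0]. For generation, [d] variables suffice by degree and
    stability. *)
Lemma alg_indep_generators_HL_Q : alg_indep_generators (fun n => u n).
Proof.
split=> [|n p|a]; first exact: HL_Q_at0.
  move=> ev0; have [T [G [TS TG _ _]]] := HL_Q_triangular n.
  have : p \mPo U n n = 0.
    have := congr1 (fun f : symfun K => f n) ev0; rewrite symfun_mmap; exact.
  have -> : U n n = [tuple tnth T i \mPo S n n | i < n].
    by apply: eq_from_tnth => i; rewrite !tnth_mktuple TS.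
  rewrite -comp_mpolyA => /msym_fundamental_un0 pT0.
  rewrite -[p]comp_mpoly_id.
  have -> : [tuple 'X_i | i < n] = [tuple tnth T i \mPo G | i < n].
    by apply: eq_from_tnth => i; rewrite !tnth_mktuple TG.
  by rewrite -comp_mpolyA pT0 comp_mpoly0.
have /asboolP[a_sym aD [d ad]] := symfunP a.
have [T [G [TS _ GT Gsize]]] := HL_Q_triangular d.
have [q [qS qw]] := sym_fundamental (a_sym d).
(* [a d] is [q] at the elementary polynomials, and [G] expresses these through the [u]. *)
exists d, (q \mPo G).
set b := mmap _ _ _.
have bE N : b N = q \mPo [tuple tnth G i \mPo U d N | i < d].
  by rewrite /b symfun_mmap comp_mpolyA.
have /asboolP[b_sym bD _] := symfunP b.
have bd : b d = a d.
  rewrite bE -qS; congr (_ \mPo _); apply: eq_from_tnth => i; rewrite !tnth_mktuple.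
  have -> : U d d = [tuple tnth T j \mPo S d d | j < d].
    by apply: eq_from_tnth => j; rewrite !tnth_mktuple TS.
  by rewrite -comp_mpolyA GT comp_mpolyXU -tnth_nth tnth_mktuple.
(* Degrees are below [d], so [drop_var_inj] propagates the equality upwards from [d] variables. *)
have up k : b (d + k)%N = a (d + k)%N.
  elim: k => [|k IHk]; first by rewrite addn0.
  rewrite addnS; apply/eqP; rewrite -subr_eq0; apply/eqP; apply: drop_var_inj.
  - exact: rpredB (b_sym _) (a_sym _).
  - have leM : (d <= (d + k).+1)%N by rewrite leqW ?leq_addr.
    apply: leq_trans leM; apply: leq_trans (msizeD_le _ _) _.
    rewrite geq_max msizeN ad andbT bE.
    have [->|q0] := eqVneq q 0; first by rewrite comp_mpoly0 msize0.
    have d0 : (0 < d)%N by rewrite (leq_trans _ (leq_trans qw (ad d))) // lt0n mmeasure_poly_eq0.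
    rewrite -[X in (_ <= X)%N](prednK d0); apply: msize_comp_mpoly => [m mq|m _ i _].
      by rewrite -ltnS prednK //; apply: leq_trans (leq_trans qw (ad d)); apply: mmeasure_mnm_lt mq.
    by rewrite tnth_mktuple; apply: Gsize.
  by rewrite /drop_var raddfB /= -!/(drop_var _) bD aD IHk subrr.
apply: val_inj; apply: functional_extensionality_dep => N.
suff down k : forall M, (d <= M + k)%N -> b M = a M by exact: (down d) (leq_addl _ _).
elim: k => [|k IHk] M; first by rewrite addn0 => /subnKC <-; apply: up.
by move=> leM; rewrite -[LHS]bD -[RHS]aD IHk // addSnnS.
Qed.

End Generators.

Theorem theorem4p4 (F : fieldType) (charF : [pchar F] =i pred0)
    (la : nat -> seq nat) (hla : forall n : nat, is_partition n (la n)) :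
  alg_indep_generators
    (fun n : nat => HL_Q_at (la n) (tofrac 'X : {fraction {poly F}})) /\
  (forall xi : F, xi != 0 -> (forall k : nat, (0 < k)%N -> xi ^+ k != 1) ->
    alg_indep_generators (fun n : nat => HL_Q_at (la n) xi)).
Proof.
split=> [|xi xi0 xiX]; last exact: alg_indep_generators_HL_Q.
(* In [F(t)] no positive power of the indeterminate is 1, because ['X^k - 1] is monic. *)
apply: alg_indep_generators_HL_Q => // [|k k0]; first by rewrite tofrac_eq0 polyX_eq0.
rewrite -tofracXn -tofrac1 tofrac_eq -subr_eq0 monic_neq0 //.
exact: monicXnsubC.
Qed.
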